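(* Let $\mathcal G$ be a groupoid acting without inversion of edges on a forest $F$ such that every fiber $xF$, $x\in\mathcal G^{(0)}$, is a tree. Let $\mathfrak D(\mathcal G,F)$ be a desingularization of the action with graph of groupoids $\mathcal G(\Gamma)$ satisfying the wideness assumption, let $\pi_1(\mathcal G(\Gamma))$ be its fundamental groupoid and $X_{\mathcal G(\Gamma)}$ its Bass-Serre forest. Let $\psi:\pi_1(\mathcal G(\Gamma))\to\mathcal G$ be the groupoid homomorphism determined by $\psi(g)=g$ for $g\in\mathcal G_v$, $v\in\Gamma^0$, and $\psi((\phi_e(x),x))=g_{e,x}$ for $e\in\Gamma^1$, $x\in\mathcal G_{o(e)}^{(0)}$, and let $\Psi=(\Psi^0,\Psi^1):X_{\mathcal G(\Gamma)}\to F$ be the graph homomorphism given by $$\Psi^0(p\,\mathcal G_v[v])=\psi(p)\cdot\sigma_v(\psi(s(p))),\qquad \Psi^1(p\,\mathcal H_{|e|}[e])=\psi(p)\cdot\sigma_e(\psi(s(p))).$$ Then $\psi$ is an isomorphism of groupoids and $\Psi$ is an isomorphism of graphs.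
   Context: **Groupoids.** A groupoid $\mathcal G$ is a small category with all morphisms invertible; $\mathcal G^{(0)}$ is its set of objects (units, identified with identity morphisms), $r,s:\mathcal G\to\mathcal G^{(0)}$ are range and source, and $gh$ is defined iff $s(g)=r(h)$. A subgroupoid is wide if it contains all units. **Graphs.** A graph $\Gamma$ (Serre) has a vertex set $\Gamma^0$, an edge set $\Gamma^1$, maps $o,t:\Gamma^1\to\Gamma^0$ and $e\mapsto\bar e$ on $\Gamma^1$ with $\bar e\ne e$, $\bar{\bar e}=e$, $t(\bar e)=o(e)$. Graph homomorphisms commute with $o,t,\bar{\ }$. A path $e_1\cdots e_n$ satisfies $o(e_i)=t(e_{i+1})$; it is reduced if $e_{i+1}\neq\bar e_i$ for all $i$. A tree is a connected graph whose only reduced closed paths have length $0$; a forest is a graph whose connected components are trees. An orientation $\Gamma^1_+$ contains exactly one edge of each pair $\{e,\bar e\}$. **Actions.** $\mathcal G$ acts on a graph $F$ if there are a surjection $\varphi:F^0\to\mathcal G^{(0)}$ (the momentum) with $\varphi\circ o=\varphi\circ t$, and maps $(g,v)\mapsto g\cdot v$ (defined for $v\in F^0$, $s(g)=\varphi(v)$) and $(g,e)\mapsto g\cdot e$ (defined for $e\in F^1$, $s(g)=\varphi(t(e))$) such that: $\varphi(g\cdot v)=r(g)$ and $\varphi(t(g\cdot e))=r(g)$; $g_1\cdot(g_2\cdot y)=(g_1g_2)\cdot y$ whenever $s(g_1)=r(g_2)$ and $g_2\cdot y$ is defined; units act as the identity; $o(g\cdot e)=g\cdot o(e)$ and $t(g\cdot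 e)=g\cdot t(e)$. The action is without inversion if $g\cdot e\neq\bar e$ always. For $x\in\mathcal G^{(0)}$, $xF$ is the subgraph with vertex set $\varphi^{-1}(x)$ and edge set $t^{-1}(\varphi^{-1}(x))$. The saturation $S(U)$ of a set $U$ of vertices (edges) is the union of the $\mathcal G$-orbits meeting $U$. **Partial sections.** A partial section of $F^0$ (resp. $F^1$) is a map $\sigma:A\to F^0$ (resp. $F^1$), $A\subseteq\mathcal G^{(0)}$, with $\varphi\circ\sigma=\mathrm{id}_A$ (resp. $\varphi\circ t\circ\sigma=\mathrm{id}_A$). Its stabilizer is the subgroupoid $\mathrm{Stab}_{\mathcal G}(\sigma)=\{g\in\mathcal G: s(g),r(g)\in A,\ g\cdot\sigma(s(g))=\sigma(r(g))\}$, with unit space $A$. **Graph of groupoids.** A graph of groupoids $\mathcal G(\Gamma)$ on a connected graph $\Gamma$ consists of groupoids $\mathcal G_v$ ($v\in\Gamma^0$), $\mathcal G_e=\mathcal G_{\bar e}$ ($e\in\Gamma^1$) and injective groupoid homomorphisms $\alpha_e:\mathcal G_e\to\mathcal G_{t(e)}$. Wideness assumption: $\alpha_e(\mathcal G_e)$ is a wide subgroupoid of $\mathcal G_{t(e)}$ for all $e\in\Gamma^1$. **Desingularization.** A desingularization of the action of $\mathcal G$ on $F$ consists of: a connected graph $\Gamma$; a maximal subtree $T\subseteq\Gamma$ (so $T^0=\Gamma^0$) with a root $r\in T^0$; an orientation $\Gamma^1_+=T^1_+\sqcup\Upsilon_+$ with $T^1_+$ an orientation of $T$ and $\Upsilon_+\cap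 T^1=\emptyset$, and $\Upsilon_-=\{\bar f: f\in\Upsilon_+\}$; partial sections $\sigma_v:X_v\to F^0$ ($v\in\Gamma^0$) and $\sigma_e:X_e\to F^1$ ($e\in\Gamma^1$) with $X_{\bar e}=X_e$, $\sigma_{\bar e}=\overline{\sigma_e}$; elements $g_{e,x}\in\mathcal G$ for $e\in\Upsilon_-$, $x\in X_e$; such that 1. $X_r=\mathcal G^{(0)}$; the saturations $S(\sigma_v(X_v))$, $v\in\Gamma^0$, are pairwise disjoint with union $F^0$; 2. for $e\in T^1$: $X_e\subseteq X_{o(e)}\cap X_{t(e)}$ and $o(\sigma_e(x))=\sigma_{o(e)}(x)$, $t(\sigma_e(x))=\sigma_{t(e)}(x)$ for $x\in X_e$; moreover for $v\in T^0$, $x\in X_v$ one has $x\in X_e$ for every edge $e$ of the reduced path in $T$ from $v$ to $r$; 3. for $e\in\Upsilon_-$, $x\in X_e$: $x\in X_{o(e)}$, $o(\sigma_e(x))=\sigma_{o(e)}(x)$, $s(g_{e,x})=x$ and $g_{e,x}\cdot t(\sigma_e(x))\in\sigma_{t(e)}(X_{t(e)})$; 4. the saturations $S(\sigma_e(X_e))$, $e\in\Gamma^1$, are pairwise disjoint with union $F^1$; 5. the graph of groupoids $\mathcal G(\Gamma)$ has $\mathcal G_v=\mathrm{Stab}_{\mathcal G}(\sigma_v)$, $\mathcal G_e=\mathcal G_{\bar e}=\mathrm{Stab}_{\mathcal G}(\sigma_e)$; $\alpha_e$ is the inclusion for $e\in T^1\sqcup\Upsilon_+$; for $e\in\Upsilon_-$,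 $\alpha_e(k)=g_{e,r(k)}\,k\,g_{e,s(k)}^{-1}$ (required to be an injective homomorphism into $\mathcal G_{t(e)}$). Under the wideness assumption all $X_v$ and $X_e$ equal $\mathcal G^{(0)}$. Further put $g_{e,x}=\mathrm{id}_x$ for $e\in T^1$, and for $e\in\Upsilon_+$ put $g_e=g_{\bar e}^{-1}$, i.e. $g_{e,y}=g_{\bar e,x}^{-1}$ where $y=r(g_{\bar e,x})$ (this defines $g_{e,y}$ for all $y\in\mathcal G_{o(e)}^{(0)}$). **Fundamental groupoid.** Put $\mathcal H_e=\alpha_e(\mathcal G_e)$ and $\phi_e=\alpha_e\circ\alpha_{\bar e}^{-1}:\mathcal H_{\bar e}\to\mathcal H_e$; by wideness $\phi_e$ restricts to a bijection $\mathcal G_{o(e)}^{(0)}\to\mathcal G_{t(e)}^{(0)}$. The bijections $\phi_e$, $e\in T^1$, generate an equivalence relation on $\bigsqcup_v\mathcal G_v^{(0)}$ for which $X=\mathcal G_r^{(0)}$ is a set of representatives; let $\tau:\bigsqcup_v\mathcal G_v^{(0)}\to X$ send each element to its representative. $\pi_1(\mathcal G(\Gamma))$ is the groupoid with unit space $X$ presented by: generators all $g\in\mathcal G_v$ ($v\in\Gamma^0$), with range $\tau(r(g))$ and source $\tau(s(g))$, and symbols $(\phi_e(x),x)$, one for each $e\in\Gamma^1$ and $x\in\mathcal G_{o(e)}^{(0)}$, with range $\tau(\phi_e(x))$ and source $\tau(x)$; relations: those of the vertex groupoids (a unit $y$ of $\mathcal G_v$ being identified with $\tau(y)$); $(\phi_e(x),x)^{-1}=(x,\phi_e(x))$,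 the latter being the symbol of $\bar e$ and $\phi_e(x)$; (R1) $(\phi_e(x),x)=\mathrm{id}_{\tau(x)}$ for $e\in T^1$; (R2) $(\alpha_e(r(g)),\alpha_{\bar e}(r(g)))\cdot\alpha_{\bar e}(g)\cdot(\alpha_{\bar e}(s(g)),\alpha_e(s(g)))=\alpha_e(g)$ for $g\in\mathcal G_e$, $e\in\Gamma^1$. **Bass-Serre forest.** Let $\varepsilon(e)=0$ if $e\in\Gamma^1_+$, $\varepsilon(e)=1$ otherwise, and let $|e|$ be the element of $\{e,\bar e\}\cap\Gamma^1_+$. For $p\in\pi_1(\mathcal G(\Gamma))$ and a vertex groupoid or subgroupoid $\mathcal K$ of one, $p\mathcal K=\{pk: k\in\mathcal K,\ s(p)=\tau(r(k))\}$. The graph $X_{\mathcal G(\Gamma)}$ has vertices the cosets $p\mathcal G_v$ tagged by $v$, written $p\mathcal G_v[v]$ ($v\in\Gamma^0$, $p\in\pi_1(\mathcal G(\Gamma))$), and edges the cosets $p\mathcal H_{|e|}$ tagged by $e$, written $p\mathcal H_{|e|}[e]$ ($e\in\Gamma^1$), with $o(p\mathcal H_{|e|}[e])=pe^{1-\varepsilon(e)}\mathcal G_{o(e)}[o(e)]$, $t(p\mathcal H_{|e|}[e])=pe^{-\varepsilon(e)}\mathcal G_{t(e)}[t(e)]$, $\overline{p\mathcal H_{|e|}[e]}=p\mathcal H_{|\bar e|}[\bar e]$. Here $pe^0=p$, $pe=p\cdot(\phi_e(y),y)$ with $y\in\mathcal G_{o(e)}^{(0)}$ the unit with $\tau(\phi_e(y))=s(p)$,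 and $pe^{-1}=p\bar e$. *)

(* Defs.v *)
From mathcomp Require Import all_boot.
From mathcomp Require Import boolp classical_sets.
From Stdlib Require Import Relations.
From Stdlib Require List.

Set Implicit Arguments.
Unset Strict Implicit.
Unset Printing Implicit Defensive.

Local Open Scope classical_set_scope.
Local Open Scope quotient_scope.

Lemma sval_inj (T : Type) (P : T -> Prop) : injective (@sval T P).
Proof. by move=> [x px] [y py] /= xy; subst y; rewrite (Prop_irrelevance px py). Qed.

Definition choose_in (T : Type) (x0 : T) (P : set T) : T :=
  xget (x0 : {classic T}) P.

Lemma choose_inP (T : Type) (x0 : T) (P : set T) :
  (exists x, P x) -> P (choose_in x0 P).
Proof. exact: (@xgetPex {classic T}). Qed.

Lemma choose_in_uniq (T : Type) (x0 x : T) (P : set T) :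
  P x -> (forall y, P y -> y = x) -> choose_in x0 P = x.
Proof. by move=> Px uP; apply: uP; apply: choose_inP; exists x. Qed.

Lemma choose_in_irr (T : Type) (x0 y0 : T) (P : set T) :
  (exists x, P x) -> choose_in x0 P = choose_in y0 P.
Proof.
rewrite /choose_in /xget => -[x Px].
case: pselect => // nP; by exfalso; apply: nP; exists x; apply/asboolP.
Qed.

(* Composition is a total function of which only the values on composable
   pairs are constrained; [gmul g h] reads g h and is meaningful when
   [gsrc g = grng h]. *)
Record groupoid := Groupoid {
  gobj : Type;
  garr : Type;
  grng : garr -> gobj;
  gsrc : garr -> gobj;
  gid : gobj -> garr;
  ginv : garr -> garr;
  gmul : garr -> garr -> garr;
  grng_id : forall x, grng (gid x) = x;
  gsrc_id : forall x, gsrc (gid x) = x;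
  grng_inv : forall g, grng (ginv g) = gsrc g;
  gsrc_inv : forall g, gsrc (ginv g) = grng g;
  grng_mul : forall g h, gsrc g = grng h -> grng (gmul g h) = grng g;
  gsrc_mul : forall g h, gsrc g = grng h -> gsrc (gmul g h) = gsrc h;
  gmulA : forall g h k, gsrc g = grng h -> gsrc h = grng k ->
    gmul g (gmul h k) = gmul (gmul g h) k;
  gmul1g : forall g, gmul (gid (grng g)) g = g;
  gmulg1 : forall g, gmul g (gid (gsrc g)) = g;
  gmulVg : forall g, gmul (ginv g) g = gid (gsrc g);
  gmulgV : forall g, gmul g (ginv g) = gid (grng g)
}.

Record groupoid_hom (G H : groupoid) := GroupoidHom {
  hom_obj : gobj G -> gobj H;
  hom_arr :> garr G -> garr H;
  hom_rng : forall g, grng (hom_arr g) = hom_obj (grng g);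
  hom_src : forall g, gsrc (hom_arr g) = hom_obj (gsrc g);
  hom_mul : forall g h, gsrc g = grng h ->
    hom_arr (gmul g h) = gmul (hom_arr g) (hom_arr h)
}.

Definition groupoid_iso (G H : groupoid) (f : groupoid_hom G H) : Prop :=
  exists f' : groupoid_hom H G,
    [/\ cancel f f', cancel f' f,
        cancel (hom_obj f) (hom_obj f') & cancel (hom_obj f') (hom_obj f)].

(* As for [{group gT}] in MathComp, subgroupoids are sets of arrows of an
   ambient groupoid. *)
Definition subgroupoid (G : groupoid) (K : set (garr G)) : Prop :=
  (forall g, K g -> K (ginv g)) /\
  (forall g h, K g -> K h -> gsrc g = grng h -> K (gmul g h)).

Definition units (G : groupoid) (K : set (garr G)) : set (gobj G) :=
  [set x | K (gid x)].

Definition wide_in (G : groupoid) (K L : set (garr G)) : Prop :=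
  K `<=` L /\ units L `<=` units K.

(* Homomorphism of groupoids on the subgroupoid [K]; nothing is asserted about
   the values of [f] outside [K]. *)
Definition hom_on (G H : groupoid) (K : set (garr G)) (f : garr G -> garr H) :=
  forall g h, K g -> K h -> gsrc g = grng h ->
    gsrc (f g) = grng (f h) /\ f (gmul g h) = gmul (f g) (f h).

Lemma gidem (G : groupoid) (g : garr G) : gsrc g = grng g -> gmul g g = g -> g = gid (grng g).
Proof.
move=> sr gg; have := congr1 (gmul (ginv g)) gg.
rewrite gmulA ?gsrc_inv // gmulVg sr gmul1g //.
Qed.

Section GroupoidLemmas.
Variable G : groupoid.
Implicit Types g h k : garr G.

Lemma subgroupoid_rng K g : subgroupoid K -> K g -> units K (grng g).
Proof.
move=> [Kinv Kmul] Kg; rewrite /units /= -gmulgV.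
by apply: Kmul => //; [apply: Kinv | rewrite grng_inv].
Qed.

Lemma subgroupoid_src K g : subgroupoid K -> K g -> units K (gsrc g).
Proof.
move=> [Kinv Kmul] Kg; rewrite /units /= -gmulVg.
by apply: Kmul => //; [apply: Kinv | rewrite gsrc_inv].
Qed.

Lemma hom_on_id (H : groupoid) K (f : garr G -> garr H) x : hom_on K f ->
  units K x -> f (gid x) = gid (grng (f (gid x))).
Proof.
move=> hf Kx; have xx : gsrc (gid x) = grng (gid x) by rewrite gsrc_id grng_id.
have [sr ff] := hf _ _ Kx Kx xx.
apply: gidem => //; rewrite -ff; congr f.
by rewrite -{1}[x]grng_id gmul1g.
Qed.

Lemma hom_on_rng (H : groupoid) K (f : garr G -> garr H) g : subgroupoid K ->
  hom_on K f -> K g -> grng (f g) = grng (f (gid (grng g))).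
Proof.
move=> sK hf Kg; have Kr := subgroupoid_rng sK Kg.
have [<- _] := hf _ _ Kr Kg (gsrc_id _).
by rewrite (hom_on_id hf Kr) gsrc_id grng_id.
Qed.

Lemma hom_on_src (H : groupoid) K (f : garr G -> garr H) g : subgroupoid K ->
  hom_on K f -> K g -> gsrc (f g) = grng (f (gid (gsrc g))).
Proof.
move=> sK hf Kg; have Ks := subgroupoid_src sK Kg.
by have [-> _] := hf _ _ Kg Ks (esym (grng_id _)).
Qed.

End GroupoidLemmas.

Record graph := Graph {
  vert : Type;
  edge : Type;
  org : edge -> vert;
  trm : edge -> vert;
  bar : edge -> edge;
  bar_neq : forall e, bar e <> e;
  barK : forall e, bar (bar e) = e;
  trm_bar : forall e, trm (bar e) = org e
}.

Lemma org_bar (F : graph) (e : edge F) : org (bar e) = trm e.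
Proof. by rewrite -trm_bar barK. Qed.

Record graph_hom (F F' : graph) := GraphHom {
  hom_vert : vert F -> vert F';
  hom_edge : edge F -> edge F';
  hom_org : forall e, org (hom_edge e) = hom_vert (org e);
  hom_trm : forall e, trm (hom_edge e) = hom_vert (trm e);
  hom_bar : forall e, bar (hom_edge e) = hom_edge (bar e)
}.

Definition graph_iso (F F' : graph) (f : graph_hom F F') : Prop :=
  exists f' : graph_hom F' F,
    [/\ cancel (hom_vert f) (hom_vert f'), cancel (hom_vert f') (hom_vert f),
        cancel (hom_edge f) (hom_edge f') & cancel (hom_edge f') (hom_edge f)].

(* [gpath y [:: e_1; ...; e_n] x]: e_1 ... e_n is a path from x to y, that is
   t(e_1) = y, o(e_i) = t(e_(i+1)) and o(e_n) = x. *)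
Fixpoint gpath (F : graph) (y : vert F) (p : seq (edge F)) (x : vert F) : Prop :=
  if p is e :: q then trm e = y /\ gpath (org e) q x else y = x.

Fixpoint reduced (F : graph) (p : seq (edge F)) : Prop :=
  if p is e :: q then
    (if q is f :: _ then f <> bar e else True) /\ reduced q
  else True.

Definition graph_connected (F : graph) : Prop :=
  forall y x : vert F, exists p, gpath y p x.

Definition is_tree (F : graph) : Prop :=
  graph_connected F /\
  forall (x : vert F) p, gpath x p x -> reduced p -> p = [::].

Record subgraph (F : graph) := Subgraph {
  sub_vert : set (vert F);
  sub_edge : set (edge F);
  sub_org : forall e, sub_edge e -> sub_vert (org e);
  sub_bar : forall e, sub_edge e -> sub_edge (bar e)
}.

Lemma sub_trm (F : graph) (S : subgraph F) e : sub_edge S e -> sub_vert S (trm e).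
Proof. by move=> Se; rewrite -org_bar; apply/sub_org/sub_bar. Qed.

Section SubgraphGraph.
Variables (F : graph) (S : subgraph F).

Local Notation V := {v : vert F | sub_vert S v}.
Local Notation E := {e : edge F | sub_edge S e}.
Definition subg_org (e : E) : V := exist _ (org (sval e)) (sub_org (svalP e)).
Definition subg_trm (e : E) : V := exist _ (trm (sval e)) (sub_trm (svalP e)).
Definition subg_bar (e : E) : E := exist _ (bar (sval e)) (sub_bar (svalP e)).

Lemma subg_bar_neq e : subg_bar e <> e.
Proof. by move/(congr1 sval); apply: bar_neq. Qed.

Lemma subg_barK e : subg_bar (subg_bar e) = e.
Proof. by apply: sval_inj; rewrite /= barK. Qed.

Lemma subg_trm_bar e : subg_trm (subg_bar e) = subg_org e.
Proof. by apply: sval_inj; rewrite /= trm_bar. Qed.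

Definition graph_of_subgraph : graph := Graph subg_bar_neq subg_barK subg_trm_bar.

End SubgraphGraph.

Coercion graph_of_subgraph : subgraph >-> graph.

Section Component.
Variables (F : graph) (v : vert F).

Definition comp_vert : set (vert F) := [set w | exists p, gpath w p v].
Definition comp_edge : set (edge F) := [set e | comp_vert (org e)].

Lemma comp_bar e : comp_edge e -> comp_edge (bar e).
Proof. by case=> p hp; exists (e :: p); rewrite /comp_vert /= org_bar. Qed.

Definition component : subgraph F :=
  @Subgraph F comp_vert comp_edge (fun e he => he) comp_bar.

End Component.

Definition is_forest (F : graph) : Prop := forall v : vert F, is_tree (component v).

Definition subgraph_le (F : graph) (S S' : subgraph F) : Prop :=
  sub_vert S `<=` sub_vert S' /\ sub_edge S `<=` sub_edge S'.

(* The last field is a consequence of maximality when [F] is connected. *)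
Record maximal_subtree (F : graph) := MaximalSubtree {
  mtree :> subgraph F;
  mtree_tree : is_tree mtree;
  mtree_max : forall S : subgraph F,
    is_tree S -> subgraph_le mtree S -> subgraph_le S mtree;
  mtree_vert : forall v, sub_vert mtree v
}.

Definition orientation (F : graph) (S P : set (edge F)) : Prop :=
  P `<=` S /\ forall e, S e -> (P e /\ ~ P (bar e)) \/ (~ P e /\ P (bar e)).

(* The maps [actV] and [actE] are total; only their values at pairs where the
   action is defined are constrained. *)
Record action (G : groupoid) (F : graph) := Action {
  mom : vert F -> gobj G;
  actV : garr G -> vert F -> vert F;
  actE : garr G -> edge F -> edge F;
  mom_surj : forall x, exists v, mom v = x;
  mom_org : forall e, mom (org e) = mom (trm e);
  mom_actV : forall g v, gsrc g = mom v -> mom (actV g v) = grng g;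
  mom_actE : forall g e, gsrc g = mom (trm e) -> mom (trm (actE g e)) = grng g;
  actV_mul : forall g h v, gsrc g = grng h -> gsrc h = mom v ->
    actV g (actV h v) = actV (gmul g h) v;
  actE_mul : forall g h e, gsrc g = grng h -> gsrc h = mom (trm e) ->
    actE g (actE h e) = actE (gmul g h) e;
  actV_id : forall v, actV (gid (mom v)) v = v;
  actE_id : forall e, actE (gid (mom (trm e))) e = e;
  org_actE : forall g e, gsrc g = mom (trm e) -> org (actE g e) = actV g (org e);
  trm_actE : forall g e, gsrc g = mom (trm e) -> trm (actE g e) = actV g (trm e)
}.

Section ActionDefs.
Variables (G : groupoid) (F : graph) (A : action G F).

Definition momE (e : edge F) : gobj G := mom A (trm e).

Definition without_inversion : Prop :=
  forall g e, gsrc g = momE e -> actE A g e <> bar e.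

Section Fiber.
Variable x : gobj G.

Definition fib_vert : set (vert F) := [set v | mom A v = x].
Definition fib_edge : set (edge F) := [set e | momE e = x].

Lemma fib_org e : fib_edge e -> fib_vert (org e).
Proof. by rewrite /fib_vert /= mom_org. Qed.

Lemma fib_bar e : fib_edge e -> fib_edge (bar e).
Proof. by rewrite /fib_edge /= /momE trm_bar mom_org. Qed.

Definition fiber : subgraph F := Subgraph fib_org fib_bar.

End Fiber.

Definition satV (U : set (vert F)) : set (vert F) :=
  [set w | exists g u, [/\ U u, gsrc g = mom A u & w = actV A g u]].

Definition satE (U : set (edge F)) : set (edge F) :=
  [set f | exists g u, [/\ U u, gsrc g = momE u & f = actE A g u]].

(* A partial section is a map [sig] considered on its domain [dom] only. *)
Definition sectionV (dom : set (gobj G)) (sig : gobj G -> vert F) : Prop :=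
  forall x, dom x -> mom A (sig x) = x.

Definition sectionE (dom : set (gobj G)) (sig : gobj G -> edge F) : Prop :=
  forall x, dom x -> momE (sig x) = x.

Definition stabV (dom : set (gobj G)) (sig : gobj G -> vert F) : set (garr G) :=
  [set g | [/\ dom (gsrc g), dom (grng g) &
               actV A g (sig (gsrc g)) = sig (grng g)]].

Definition stabE (dom : set (gobj G)) (sig : gobj G -> edge F) : set (garr G) :=
  [set g | [/\ dom (gsrc g), dom (grng g) &
               actE A g (sig (gsrc g)) = sig (grng g)]].

End ActionDefs.

(* The vertex and edge groupoids are subgroupoids of an ambient groupoid [U],
   so that G_e = G_(bar e) and t(bar e) = o(e) involve no transport between
   types; for an arbitrary family one may take [U] to be the disjoint union. *)
Record graph_of_groupoids (Gam : graph) (U : groupoid) := GraphOfGroupoids {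
  gg_vert : vert Gam -> set (garr U);
  gg_edge : edge Gam -> set (garr U);
  gg_alpha : edge Gam -> garr U -> garr U;
  gg_conn : graph_connected Gam;
  gg_vert_sub : forall v, subgroupoid (gg_vert v);
  gg_edge_sub : forall e, subgroupoid (gg_edge e);
  gg_edge_bar : forall e, gg_edge (bar e) = gg_edge e;
  gg_alpha_in : forall e g, gg_edge e g -> gg_vert (trm e) (gg_alpha e g);
  gg_alpha_hom : forall e, hom_on (gg_edge e) (gg_alpha e);
  gg_alpha_inj : forall e g h, gg_edge e g -> gg_edge e h ->
    gg_alpha e g = gg_alpha e h -> g = h
}.

Definition gg_H (Gam : graph) (U : groupoid) (GG : graph_of_groupoids Gam U)
  (e : edge Gam) : set (garr U) := gg_alpha GG e @` gg_edge GG e.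

Definition wide (Gam : graph) (U : groupoid) (GG : graph_of_groupoids Gam U) :=
  forall e, wide_in (gg_H GG e) (gg_vert GG (trm e)).

Section Phi.
Variables (Gam : graph) (U : groupoid) (GG : graph_of_groupoids Gam U).
Implicit Types (e : edge Gam) (x y : gobj U).

Definition gg_alpha_inv e (h : garr U) : garr U :=
  choose_in h [set g | gg_edge GG e g /\ gg_alpha GG e g = h].

Definition gg_phi e (h : garr U) : garr U :=
  gg_alpha GG e (gg_alpha_inv (bar e) h).

(* The maps induced by alpha_e and phi_e on units. *)
Definition alpha0 e x : gobj U := grng (gg_alpha GG e (gid x)).
Definition phi0 e x : gobj U := grng (gg_phi e (gid x)).

Lemma gg_alpha_invK e g : gg_edge GG e g -> gg_alpha_inv e (gg_alpha GG e g) = g.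
Proof.
move=> Eg; apply: choose_in_uniq => // h [Eh]; exact: gg_alpha_inj.
Qed.

Lemma gg_edge_barP e g : gg_edge GG e g <-> gg_edge GG (bar e) g.
Proof. by rewrite gg_edge_bar. Qed.

Lemma gg_alpha_id e x : units (gg_edge GG e) x ->
  gg_alpha GG e (gid x) = gid (alpha0 e x).
Proof. exact: hom_on_id (@gg_alpha_hom _ _ GG e). Qed.

Lemma grng_alpha e g : gg_edge GG e g ->
  grng (gg_alpha GG e g) = alpha0 e (grng g).
Proof. exact: hom_on_rng (gg_edge_sub GG e) (@gg_alpha_hom _ _ GG e). Qed.

Lemma gsrc_alpha e g : gg_edge GG e g ->
  gsrc (gg_alpha GG e g) = alpha0 e (gsrc g).
Proof. exact: hom_on_src (gg_edge_sub GG e) (@gg_alpha_hom _ _ GG e). Qed.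

Lemma alpha0_unit e x : units (gg_edge GG e) x ->
  units (gg_vert GG (trm e)) (alpha0 e x).
Proof. by move=> Ex; rewrite /units /= -gg_alpha_id //; apply: gg_alpha_in. Qed.

Lemma alpha0_bar_unit e x : units (gg_edge GG e) x ->
  units (gg_vert GG (org e)) (alpha0 (bar e) x).
Proof.
by move=> Ex; rewrite -trm_bar; apply: alpha0_unit; rewrite /units /= gg_edge_bar.
Qed.

Lemma phi0_alpha0 e x : units (gg_edge GG e) x ->
  phi0 e (alpha0 (bar e) x) = alpha0 e x.
Proof.
move=> Ex; have Ex' : units (gg_edge GG (bar e)) x by rewrite /units gg_edge_bar.
by rewrite /phi0 /gg_phi -gg_alpha_id // gg_alpha_invK.
Qed.

Lemma wide_unit e y : wide GG -> units (gg_vert GG (trm e)) y ->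
  exists2 x, units (gg_edge GG e) x & y = alpha0 e x.
Proof.
move=> wG Gy; have [_ /(_ y Gy) [g Eg gy]] := wG e.
exists (grng g); first exact: subgroupoid_rng (gg_edge_sub GG e) Eg.
by rewrite -grng_alpha // gy grng_id.
Qed.

Lemma wide_unit_org e y : wide GG -> units (gg_vert GG (org e)) y ->
  exists2 x, units (gg_edge GG e) x & y = alpha0 (bar e) x.
Proof.
move=> wG; rewrite -trm_bar => /(wide_unit wG) [x Ex ->].
by exists x => //; move: Ex; rewrite /units gg_edge_bar.
Qed.

Lemma phi0_unit e y : wide GG -> units (gg_vert GG (org e)) y ->
  units (gg_vert GG (trm e)) (phi0 e y).
Proof.
move=> wG /(wide_unit_org wG) [x Ex ->].
by rewrite phi0_alpha0 //; apply: alpha0_unit.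
Qed.

Lemma phi0_barK e y : wide GG -> units (gg_vert GG (org e)) y ->
  phi0 (bar e) (phi0 e y) = y.
Proof.
move=> wG /(wide_unit_org wG) [x Ex ->].
rewrite phi0_alpha0 //; have := @phi0_alpha0 (bar e) x.
by rewrite barK; apply; rewrite /units gg_edge_bar.
Qed.

End Phi.

Inductive word (O A : Type) :=
  | Wid of O
  | Wgen of A
  | Winv of word O A
  | Wmul of word O A & word O A.
Arguments Wid {O A}.
Arguments Wgen {O A}.

Section Words.
Variables (O A : Type) (X : set O) (gens : set A) (rA sA : A -> O).
Local Notation word := (word O A).

Fixpoint wrng (t : word) : O :=
  match t with
  | Wid x => x | Wgen a => rA a | Winv t => wsrc t | Wmul t _ => wrng t
  end
with wsrc (t : word) : O :=
  match t with
  | Wid x => x | Wgen a => sA a | Winv t => wrng t | Wmul _ u => wsrc u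
  end.

Fixpoint wwf (t : word) : Prop :=
  match t with
  | Wid x => X x
  | Wgen a => gens a
  | Winv t => wwf t
  | Wmul t u => [/\ wwf t, wwf u & wsrc t = wrng u]
  end.

Definition wparallel (t u : word) : Prop :=
  [/\ wwf t, wwf u, wrng t = wrng u & wsrc t = wsrc u].

End Words.

Record presentation := Presentation {
  pr_base : Type;
  pr_unit : set pr_base;
  pr_sym : Type;
  pr_gen : set pr_sym;
  pr_rng : pr_sym -> pr_base;
  pr_src : pr_sym -> pr_base;
  pr_rel : word pr_base pr_sym -> word pr_base pr_sym -> Prop;
  pr_genP : forall a, pr_gen a -> pr_unit (pr_rng a) /\ pr_unit (pr_src a);
  pr_relP : forall t u, pr_rel t u -> wparallel pr_unit pr_gen pr_rng pr_src t u
}.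

Section PresentedGroupoid.
Variable P : presentation.
Local Notation word := (word (pr_base P) (pr_sym P)).
Local Notation wrng := (@wrng (pr_base P) (pr_sym P) (@pr_rng P) (@pr_src P)).
Local Notation wsrc := (@wsrc (pr_base P) (pr_sym P) (@pr_rng P) (@pr_src P)).
Local Notation wwf := (wwf (@pr_unit P) (@pr_gen P) (@pr_rng P) (@pr_src P)).
Local Notation wparallel :=
  (wparallel (@pr_unit P) (@pr_gen P) (@pr_rng P) (@pr_src P)).

(* A partial equivalence: [weq t t] holds exactly when [t] is well formed, and
   [weq] only relates parallel words. *)
Inductive weq : word -> word -> Prop :=
  | weq_refl t : wwf t -> weq t t
  | weq_sym t u : weq t u -> weq u t
  | weq_trans t u w : weq t u -> weq u w -> weq t w
  | weq_inv t u : weq t u -> weq (Winv t) (Winv u)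
  | weq_mul t t' u u' : wsrc t = wrng u ->
      weq t t' -> weq u u' -> weq (Wmul t u) (Wmul t' u')
  | weq_assoc t u w : wwf t -> wwf u -> wwf w -> wsrc t = wrng u ->
      wsrc u = wrng w -> weq (Wmul t (Wmul u w)) (Wmul (Wmul t u) w)
  | weq_1l t : wwf t -> weq (Wmul (Wid (wrng t)) t) t
  | weq_1r t : wwf t -> weq (Wmul t (Wid (wsrc t))) t
  | weq_Vl t : wwf t -> weq (Wmul (Winv t) t) (Wid (wsrc t))
  | weq_Vr t : wwf t -> weq (Wmul t (Winv t)) (Wid (wrng t))
  | weq_rel t u : pr_rel t u -> weq t u.

Lemma wwf_ends t : wwf t -> pr_unit (wrng t) /\ pr_unit (wsrc t).
Proof.
elim: t => [x|a|t IHt|t IHt u IHu] //=; first exact: pr_genP.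
- by move=> /IHt [].
- by case=> /IHt[? _] /IHu[_ ?] _.
Qed.

Lemma weq_parallel t u : weq t u -> wparallel t u.
Proof.
elim=> {t u}.
- by [].
- by move=> t u _ [].
- by move=> t u w _ [? ? rtu stu] _ [? ? ruw suw]; split; rewrite ?rtu ?stu.
- by move=> t u _ [? ? ? ?]; split.
- move=> t t' u u' tu _ [wt wt' rt st] _ [wu wu' ru su]; split=> //=.
  by split; rewrite // -st -ru.
- by move=> t u w wt wu ww tu uw; split.
- by move=> t wt; have [rt st] := wwf_ends wt; split.
- by move=> t wt; have [rt st] := wwf_ends wt; split.
- by move=> t wt; have [rt st] := wwf_ends wt; split.
- by move=> t wt; have [rt st] := wwf_ends wt; split.
- by move=> t u; apply: pr_relP.
Qed.

Definition wword : Type := {t : word | wwf t}.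
Definition weqb : rel {classic wword} := fun a b => `[< weq (sval a) (sval b) >].

Lemma weqb_equiv : equiv_class_of weqb.
Proof.
split=> [a|a b|b a c].
- by apply/asboolP/weq_refl/svalP.
- by apply/asboolP/asboolP => /weq_sym.
- by move=> /asboolP ab /asboolP bc; apply/asboolP/(weq_trans ab).
Qed.

Canonical weq_equiv := EquivRelPack weqb_equiv.

Definition pr_arr : Type := {eq_quot weq_equiv}.

Definition pr_cls (t : word) (wt : wwf t) : pr_arr :=
  \pi_({eq_quot weq_equiv}) (exist _ t wt : {classic wword}).

Definition pr_repr (a : pr_arr) : word :=
  sval (repr (a : {eq_quot weq_equiv}) : wword).

Lemma pr_reprP a : wwf (pr_repr a).
Proof. exact: svalP. Qed.

Lemma pr_clsE t u (wt : wwf t) (wu : wwf u) :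
  pr_cls wt = pr_cls wu <-> weq t u.
Proof.
split=> [/eqmodP/asboolP //|tu]; exact/eqmodP/asboolP.
Qed.

Lemma pr_reprK a : pr_cls (pr_reprP a) = a.
Proof.
rewrite /pr_cls /pr_repr -[RHS]reprK; congr (\pi _).
exact: sval_inj.
Qed.

Lemma pr_cls_repr t (wt : wwf t) : weq (pr_repr (pr_cls wt)) t.
Proof. by apply/(pr_clsE (pr_reprP _) wt); apply: pr_reprK. Qed.

Lemma pr_ind (Q : pr_arr -> Prop) :
  (forall t (wt : wwf t), Q (pr_cls wt)) -> forall a, Q a.
Proof. by move=> h a; rewrite -(pr_reprK a). Qed.

Definition pr_obj : Type := {x : pr_base P | pr_unit x}.

Definition pa_rng (a : pr_arr) : pr_obj :=
  exist _ (wrng (pr_repr a)) (wwf_ends (pr_reprP a)).1.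

Definition pa_src (a : pr_arr) : pr_obj :=
  exist _ (wsrc (pr_repr a)) (wwf_ends (pr_reprP a)).2.

Definition pa_id (x : pr_obj) : pr_arr := @pr_cls (Wid (sval x)) (svalP x).

Definition pa_inv (a : pr_arr) : pr_arr := @pr_cls (Winv (pr_repr a)) (pr_reprP a).

(* The value on pairs that are not composable is irrelevant. *)
Definition pa_mul (a b : pr_arr) : pr_arr :=
  match pselect (wsrc (pr_repr a) = wrng (pr_repr b)) with
  | left ab => @pr_cls (Wmul (pr_repr a) (pr_repr b))
                 (And3 (pr_reprP a) (pr_reprP b) ab)
  | right _ => a
  end.

Lemma pa_rngE t (wt : wwf t) : sval (pa_rng (pr_cls wt)) = wrng t.
Proof. by have /weq_parallel[_ _] := pr_cls_repr wt. Qed.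

Lemma pa_srcE t (wt : wwf t) : sval (pa_src (pr_cls wt)) = wsrc t.
Proof. by have /weq_parallel[_ _] := pr_cls_repr wt. Qed.

Lemma pr_objP (x y : pr_obj) : sval x = sval y -> x = y.
Proof. exact: sval_inj. Qed.

Lemma pa_comp t u (wt : wwf t) (wu : wwf u) :
  pa_src (pr_cls wt) = pa_rng (pr_cls wu) <-> wsrc t = wrng u.
Proof.
rewrite -pa_srcE -pa_rngE; split=> [-> //|]; exact: pr_objP.
Qed.

Lemma pa_idE x (wx : wwf (Wid (sval x))) : pa_id x = pr_cls wx.
Proof. exact/pr_clsE/weq_refl. Qed.

Lemma pa_invE t (wt : wwf t) (wt' : wwf (Winv t)) :
  pa_inv (pr_cls wt) = pr_cls wt'.
Proof. exact/pr_clsE/weq_inv/pr_cls_repr. Qed.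

Lemma pa_mulE t u (wt : wwf t) (wu : wwf u) (wtu : wwf (Wmul t u)) :
  pa_mul (pr_cls wt) (pr_cls wu) = pr_cls wtu.
Proof.
rewrite /pa_mul; case: pselect => [tu|ntu].
  by apply/pr_clsE/weq_mul => //; apply: pr_cls_repr.
by case: ntu; case: wtu => _ _; rewrite -pa_srcE -pa_rngE.
Qed.

Lemma pa_rng_id x : pa_rng (pa_id x) = x.
Proof. exact/pr_objP/pa_rngE. Qed.

Lemma pa_src_id x : pa_src (pa_id x) = x.
Proof. exact/pr_objP/pa_srcE. Qed.

Lemma pa_rng_inv a : pa_rng (pa_inv a) = pa_src a.
Proof. exact/pr_objP/pa_rngE. Qed.

Lemma pa_src_inv a : pa_src (pa_inv a) = pa_rng a.
Proof. exact/pr_objP/pa_srcE. Qed.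

Lemma pa_rng_mul a b : pa_src a = pa_rng b -> pa_rng (pa_mul a b) = pa_rng a.
Proof.
elim/pr_ind: a => t wt; elim/pr_ind: b => u wu /pa_comp tu.
have wtu : wwf (Wmul t u) by [].
by rewrite (pa_mulE _ _ wtu); apply: pr_objP; rewrite !pa_rngE.
Qed.

Lemma pa_src_mul a b : pa_src a = pa_rng b -> pa_src (pa_mul a b) = pa_src b.
Proof.
elim/pr_ind: a => t wt; elim/pr_ind: b => u wu /pa_comp tu.
have wtu : wwf (Wmul t u) by [].
by rewrite (pa_mulE _ _ wtu); apply: pr_objP; rewrite !pa_srcE.
Qed.

Lemma pa_mulA a b c : pa_src a = pa_rng b -> pa_src b = pa_rng c ->
  pa_mul a (pa_mul b c) = pa_mul (pa_mul a b) c.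
Proof.
elim/pr_ind: a => t wt; elim/pr_ind: b => u wu; elim/pr_ind: c => w ww.
move=> /pa_comp tu /pa_comp uw.
have wtu : wwf (Wmul t u) by [].
have wuw : wwf (Wmul u w) by [].
have w1 : wwf (Wmul t (Wmul u w)) by [].
have w2 : wwf (Wmul (Wmul t u) w) by [].
rewrite (pa_mulE _ _ wuw) (pa_mulE _ _ w1) (pa_mulE _ _ wtu) (pa_mulE _ _ w2).
exact/pr_clsE/weq_assoc.
Qed.

Lemma pa_mul1 a : pa_mul (pa_id (pa_rng a)) a = a.
Proof.
elim/pr_ind: a => t wt.
have -> : pa_rng (pr_cls wt) = exist _ (wrng t) (wwf_ends wt).1.
  by apply: pr_objP; rewrite pa_rngE.
have w1 : wwf (Wmul (Wid (wrng t)) t) by have [] := wwf_ends wt.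
rewrite /pa_id (pa_mulE _ _ w1); exact/pr_clsE/weq_1l.
Qed.

Lemma pa_mulr1 a : pa_mul a (pa_id (pa_src a)) = a.
Proof.
elim/pr_ind: a => t wt.
have -> : pa_src (pr_cls wt) = exist _ (wsrc t) (wwf_ends wt).2.
  by apply: pr_objP; rewrite pa_srcE.
have w1 : wwf (Wmul t (Wid (wsrc t))) by have [] := wwf_ends wt.
rewrite /pa_id (pa_mulE _ _ w1); exact/pr_clsE/weq_1r.
Qed.

Lemma pa_mulV a : pa_mul (pa_inv a) a = pa_id (pa_src a).
Proof.
elim/pr_ind: a => t wt.
have -> : pa_src (pr_cls wt) = exist _ (wsrc t) (wwf_ends wt).2.
  by apply: pr_objP; rewrite pa_srcE.
have wi : wwf (Winv t) by [].
have w1 : wwf (Wmul (Winv t) t) by [].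
rewrite (pa_invE _ wi) (pa_mulE _ _ w1); exact/pr_clsE/weq_Vl.
Qed.

Lemma pa_mulrV a : pa_mul a (pa_inv a) = pa_id (pa_rng a).
Proof.
elim/pr_ind: a => t wt.
have -> : pa_rng (pr_cls wt) = exist _ (wrng t) (wwf_ends wt).1.
  by apply: pr_objP; rewrite pa_rngE.
have wi : wwf (Winv t) by [].
have w1 : wwf (Wmul t (Winv t)) by [].
rewrite (pa_invE _ wi) (pa_mulE _ _ w1); exact/pr_clsE/weq_Vr.
Qed.

Definition presented_groupoid : groupoid :=
  Groupoid pa_rng_id pa_src_id pa_rng_inv pa_src_inv pa_rng_mul pa_src_mul pa_mulA
    pa_mul1 pa_mulr1 pa_mulV pa_mulrV.

End PresentedGroupoid.

Section GraphPaths.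
Variable F : graph.

Lemma gpath_cat (y x : vert F) p q :
  gpath y (p ++ q) x <-> exists z, gpath y p z /\ gpath z q x.
Proof.
elim: p y => [|e p IH] y /=; first by split=> [?|[z [->]] //]; exists y.
split=> [[ey /IH[z [? ?]]]|[z [[ey pz] zq]]]; first by exists z.
by split=> //; apply/IH; exists z.
Qed.

Definition rev_path (p : seq (edge F)) : seq (edge F) := rev (map (@bar F) p).

Lemma gpath_rev (y x : vert F) p : gpath y p x -> gpath x (rev_path p) y.
Proof.
elim: p y => [|e p IH] y //=; case=> ey /IH h.
rewrite /rev_path /= rev_cons -cats1; apply/gpath_cat; exists (org e).
by split=> //=; rewrite trm_bar org_bar.
Qed.

Lemma not_reduced (p : seq (edge F)) : ~ reduced p ->
  exists p1 e p2, p = p1 ++ e :: bar e :: p2.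
Proof.
elim: p => [|e p IH] nr; first by case: nr.
case: (pselect (reduced p)) => [rp|/IH[p1 [f [p2 ->]]]]; last first.
  by exists (e :: p1), f, p2.
case: p {IH} rp nr => [|f q] rp nr; first by case: nr.
case: (pselect (f = bar e)) => [->|fe]; first by exists [::], e, q.
by case: nr; split.
Qed.

End GraphPaths.

Section Fundamental.
Variables (Gam : graph) (U : groupoid) (GG : graph_of_groupoids Gam U).
Hypothesis wG : wide GG.
Variables (T : maximal_subtree Gam) (r : vert Gam).

Local Notation V := (vert Gam).
Local Notation E := (edge Gam).
Local Notation Gv0 v := (units (gg_vert GG v)).

Definition tree_step (a b : V * gobj U) : Prop :=
  exists e x, [/\ sub_edge T e, Gv0 (org e) x,
                  a = (org e, x) & b = (trm e, phi0 GG e x)].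

Definition tree_equiv : V * gobj U -> V * gobj U -> Prop :=
  clos_refl_sym_trans _ tree_step.

Definition tau (v : V) (y : gobj U) : gobj U :=
  choose_in y [set x | Gv0 r x /\ tree_equiv (v, y) (r, x)].

Definition tvtx (v : V) : vert T := exist _ v (mtree_vert T v).

Lemma tvtxE (v : vert T) : tvtx (sval v) = v.
Proof. exact: sval_inj. Qed.

Definition tree_tr (p : seq (edge T)) (a : gobj U) : gobj U :=
  foldr (fun (e : edge T) => phi0 GG (sval e)) a p.

Lemma tree_tr_cat p q a : tree_tr (p ++ q) a = tree_tr p (tree_tr q a).
Proof. by rewrite /tree_tr foldr_cat. Qed.

Lemma tree_tr_unit (y x : vert T) p a : gpath y p x -> Gv0 (sval x) a -> Gv0 (sval y) (tree_tr p a).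
Proof.
elim: p y => [|e p IH] y /= => [->//|[<- /IH h]] /h; exact: phi0_unit.
Qed.

Lemma tree_tr_equiv (y x : vert T) p a : gpath y p x -> Gv0 (sval x) a ->
  tree_equiv (sval x, a) (sval y, tree_tr p a).
Proof.
elim: p y => [|e p IH] y /=; first by move=> -> _; apply: rst_refl.
case=> <- hp xa; apply: rst_trans (IH _ hp xa) _; apply: rst_step.
exists (sval e), (tree_tr p a); split=> //; first exact: svalP e.
exact: tree_tr_unit hp xa.
Qed.

Lemma tree_tr_rev (y x : vert T) p a : gpath y p x -> Gv0 (sval x) a ->
  tree_tr (rev_path p) (tree_tr p a) = a.
Proof.
elim: p y => [|e p IH] y //= [_ hp] xa.
rewrite /rev_path /= rev_cons -cats1 /tree_tr foldr_cat /=.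
rewrite phi0_barK //; first exact: IH hp xa.
exact: tree_tr_unit hp xa.
Qed.

Lemma holonomy (x : vert T) p a : gpath x p x -> Gv0 (sval x) a -> tree_tr p a = a.
Proof.
have [n] := ubnP (size p); elim: n p => // n IH p sp hp xa.
case: (pselect (reduced p)) => [rp|/not_reduced[p1 [e [p2 pE]]]].
  by rewrite ((mtree_tree T).2 _ _ hp rp).
move: hp sp; rewrite {}pE => /gpath_cat[z [h1 [ez [_ h2]]]] sp.
rewrite (@org_bar T e) ez -/(@gpath T) in h2.
rewrite /tree_tr foldr_cat /= -/(tree_tr p2 a) -{1}[sval e]barK phi0_barK //; last first.
  by rewrite org_bar; have := tree_tr_unit h2 xa; rewrite -ez.
rewrite -/(tree_tr p1 _) -tree_tr_cat; apply: IH => //; last by apply/gpath_cat; exists z.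
by move: sp; rewrite !size_cat /= !addnS ltnS => /ltnW.
Qed.

Lemma equiv_path a b : tree_equiv a b ->
  (Gv0 a.1 a.2 <-> Gv0 b.1 b.2) /\
  (Gv0 a.1 a.2 -> exists2 p, gpath (tvtx b.1) p (tvtx a.1) & tree_tr p a.2 = b.2).
Proof.
elim=> {a b}.
- move=> a b [e [x [Te xu -> ->]]]; split=> /=.
    by split=> // _; apply: phi0_unit.
  move=> _; exists [:: exist _ e Te : edge T] => //=.
  by split; apply: sval_inj.
- by move=> a; split=> // _; exists [::].
- move=> a b _ [ab h]; split; first by split=> /ab.
  move=> /ab ua; have [p hp pab] := h ua.
  exists (rev_path p); first exact: gpath_rev.
  by rewrite -pab; apply: (tree_tr_rev hp).
- move=> a b c _ [ab hab] _ [bc hbc]; split; first by rewrite ab.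
  move=> ua; have [p hp pE] := hab ua; have [q hq qE] := hbc (ab.1 ua).
  exists (q ++ p); first by apply/gpath_cat; exists (tvtx b.1).
  by rewrite /tree_tr foldr_cat -/(tree_tr p _) pE.
Qed.

Lemma root_rep_ex v y : Gv0 v y ->
  exists x, Gv0 r x /\ tree_equiv (v, y) (r, x).
Proof.
move=> vy; have [p hp] := (mtree_tree T).1 (tvtx r) (tvtx v).
by exists (tree_tr p y); split; [apply: (tree_tr_unit hp) | apply: (tree_tr_equiv hp)].
Qed.

Lemma root_rep_uniq x x' : Gv0 r x -> tree_equiv (r, x) (r, x') -> x = x'.
Proof.
move=> rx /equiv_path[_ /(_ rx)[p hp]] /= <-.
by rewrite (holonomy hp).
Qed.

Lemma tau_unit v y : Gv0 v y -> Gv0 r (tau v y).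
Proof. by move=> /root_rep_ex h; have [] := choose_inP y h. Qed.

Lemma tau_equiv v y : Gv0 v y -> tree_equiv (v, y) (r, tau v y).
Proof. by move=> /root_rep_ex h; have [] := choose_inP y h. Qed.

Lemma tau_eq v y w z : Gv0 v y -> tree_equiv (v, y) (w, z) -> tau v y = tau w z.
Proof.
move=> vy eyz; rewrite /tau.
rewrite (choose_in_irr y z (root_rep_ex vy)); congr choose_in.
apply/seteqP; split=> x [rx ex]; split=> //.
  by apply: rst_trans ex; apply: rst_sym.
exact: rst_trans ex.
Qed.

Lemma tau_root x : Gv0 r x -> tau r x = x.
Proof. by move=> rx; rewrite [RHS](root_rep_uniq rx (tau_equiv rx)). Qed.

Lemma tau_tree e x : sub_edge T e -> Gv0 (org e) x ->
  tau (trm e) (phi0 GG e x) = tau (org e) x.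
Proof.
move=> Te ex; apply/esym/tau_eq => //; apply: rst_step.
by exists e, x.
Qed.

Lemma tau_surj v x : Gv0 r x -> exists2 y, Gv0 v y & tau v y = x.
Proof.
move=> rx; have [p hp] := (mtree_tree T).1 (tvtx v) (tvtx r).
exists (tree_tr p x); first exact: (tree_tr_unit hp).
rewrite -[RHS]tau_root //; apply/esym/tau_eq => //.
exact: (tree_tr_equiv hp).
Qed.

(* [gen_v v g] is the generator g of G_v and [gen_e e x] the symbol
   (phi_e(x), x). *)
Definition gen : Type := (V * garr U) + (E * gobj U).
Definition gen_v (v : V) (g : garr U) : gen := inl (v, g).
Definition gen_e (e : E) (x : gobj U) : gen := inr (e, x).

Definition is_gen : set gen := fun a =>
  match a with
  | inl (v, g) => gg_vert GG v g
  | inr (e, x) => Gv0 (org e) x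
  end.

Definition gen_rng (a : gen) : gobj U :=
  match a with
  | inl (v, g) => tau v (grng g)
  | inr (e, x) => tau (trm e) (phi0 GG e x)
  end.

Definition gen_src (a : gen) : gobj U :=
  match a with
  | inl (v, g) => tau v (gsrc g)
  | inr (e, x) => tau (org e) x
  end.

Local Notation word := (word (gobj U) gen).
Local Notation wv v g := (Wgen (gen_v v g)).
Local Notation we e x := (Wgen (gen_e e x)).

Inductive pi1_rel : word -> word -> Prop :=
  | rel_vert_mul v g h : gg_vert GG v g -> gg_vert GG v h -> gsrc g = grng h ->
      pi1_rel (Wmul (wv v g) (wv v h)) (wv v (gmul g h))
  | rel_vert_id v y : Gv0 v y -> pi1_rel (wv v (gid y)) (Wid (tau v y))
  | rel_edge_inv e x : Gv0 (org e) x ->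
      pi1_rel (Winv (we e x)) (we (bar e) (phi0 GG e x))
  | rel_R1 e x : sub_edge T e -> Gv0 (org e) x ->
      pi1_rel (we e x) (Wid (tau (org e) x))
  | rel_R2 e g : gg_edge GG e g ->
      pi1_rel (Wmul (Wmul (we e (alpha0 GG (bar e) (grng g)))
                          (wv (org e) (gg_alpha GG (bar e) g)))
                    (we (bar e) (alpha0 GG e (gsrc g))))
              (wv (trm e) (gg_alpha GG e g)).

Lemma is_gen_ends a : is_gen a -> Gv0 r (gen_rng a) /\ Gv0 r (gen_src a).
Proof.
case: a => [[v g]|[e x]] /= h; split; apply: tau_unit => //.
- exact: subgroupoid_rng (gg_vert_sub GG v) h.
- exact: subgroupoid_src (gg_vert_sub GG v) h.
- exact: phi0_unit.
Qed.

Lemma pi1_relP t u : pi1_rel t u -> wparallel (Gv0 r) is_gen gen_rng gen_src t u.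
Proof.
case=> {t u}.
- move=> v g h vg vh gh; split=> //=; rewrite ?gh ?grng_mul ?gsrc_mul //.
  exact: (gg_vert_sub GG v).2.
- by move=> v y vy; split=> //=; rewrite ?grng_id ?gsrc_id //; apply: tau_unit.
- move=> e x ex; split=> //=.
  + by rewrite org_bar; apply: phi0_unit.
  + by rewrite phi0_barK // trm_bar.
  + by rewrite org_bar.
- by move=> e x Te ex; split=> //=; [apply: tau_unit | apply: tau_tree].
- move=> e g eg; have eg' : gg_edge GG (bar e) g by rewrite gg_edge_bar.
  have ur := subgroupoid_rng (gg_edge_sub GG e) eg.
  have us := subgroupoid_src (gg_edge_sub GG e) eg.
  have ur' := subgroupoid_rng (gg_edge_sub GG (bar e)) eg'.
  have us' := subgroupoid_src (gg_edge_sub GG (bar e)) eg'.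
  have pE : phi0 GG (bar e) (alpha0 GG e (gsrc g)) = alpha0 GG (bar e) (gsrc g).
    by have := phi0_alpha0 us'; rewrite barK.
  have avo : gg_vert GG (org e) (gg_alpha GG (bar e) g).
    by rewrite -trm_bar; apply: gg_alpha_in.
  split=> /=; rewrite ?pE ?phi0_alpha0 ?grng_alpha ?gsrc_alpha ?org_bar ?trm_bar //.
  + split=> //.
    * by split=> //; apply: alpha0_bar_unit.
    * by rewrite ?org_bar; apply: alpha0_unit.
  + exact: gg_alpha_in.
Qed.

Definition pi1_presentation : presentation :=
  @Presentation (gobj U) (Gv0 r) gen is_gen gen_rng gen_src pi1_rel
    is_gen_ends pi1_relP.

Definition fundamental_groupoid : groupoid := presented_groupoid pi1_presentation.

Local Notation Pi := fundamental_groupoid.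

Definition pi1_vert (v : V) (g : garr U) (vg : gg_vert GG v g) : garr Pi :=
  @pr_cls pi1_presentation (Wgen (gen_v v g)) vg.

Definition pi1_edge (e : E) (x : gobj U) (ex : Gv0 (org e) x) : garr Pi :=
  @pr_cls pi1_presentation (Wgen (gen_e e x)) ex.

Lemma grng_pi1_vert v g (vg : gg_vert GG v g) :
  sval (grng (pi1_vert vg)) = tau v (grng g).
Proof. exact: (@pa_rngE pi1_presentation). Qed.

Lemma gsrc_pi1_vert v g (vg : gg_vert GG v g) :
  sval (gsrc (pi1_vert vg)) = tau v (gsrc g).
Proof. exact: (@pa_srcE pi1_presentation). Qed.

Lemma grng_pi1_edge e x (ex : Gv0 (org e) x) :
  sval (grng (pi1_edge ex)) = tau (trm e) (phi0 GG e x).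
Proof. exact: (@pa_rngE pi1_presentation). Qed.

Lemma gsrc_pi1_edge e x (ex : Gv0 (org e) x) :
  sval (gsrc (pi1_edge ex)) = tau (org e) x.
Proof. exact: (@pa_srcE pi1_presentation). Qed.

(* The coset p K = {p k : k in K, s(p) = tau(r(k))}, where K is a subgroupoid of
   G_v. *)
Definition coset (p : garr Pi) (v : V) (K : set (garr U)) : set (garr Pi) :=
  [set q | exists (k : garr U) (vk : gg_vert GG v k),
     [/\ K k, sval (gsrc p) = tau v (grng k) & q = gmul p (pi1_vert vk)]].

Lemma edge_unit_ex (p : garr Pi) (e : E) :
  exists y, Gv0 (org e) y /\ tau (trm e) (phi0 GG e y) = sval (gsrc p).
Proof.
have [z ez zE] := tau_surj (trm e) (svalP (gsrc p)).
have ez' : Gv0 (org (bar e)) z by rewrite org_bar.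
exists (phi0 GG (bar e) z); split.
  by have := phi0_unit wG ez'; rewrite trm_bar.
by have := phi0_barK wG ez'; rewrite barK => ->.
Qed.

(* The product p e = p (phi_e(y), y), where tau(phi_e(y)) = s(p). *)
Definition pi1_mul_edge (p : garr Pi) (e : E) : garr Pi :=
  gmul p (pi1_edge (svalP (cid (edge_unit_ex p e))).1).

Variable pos : set E.
Hypothesis posP : orientation setT pos.

Definition abs_edge (e : E) : E := if `[< pos e >] then e else bar e.

Lemma pos_bar e : `[< pos (bar e) >] = ~~ `[< pos e >].
Proof.
have [[pe npb]|[npe pb]] := posP.2 e I.
  by rewrite (asboolT pe) (asboolF npb).
by rewrite (asboolF npe) (asboolT pb).
Qed.

Lemma abs_edge_bar e : abs_edge (bar e) = abs_edge e.
Proof. by rewrite /abs_edge pos_bar barK; case: asboolP. Qed.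

Definition vcoset (p : garr Pi) (v : V) : set (garr Pi) :=
  coset p v (gg_vert GG v).

Definition ecoset (p : garr Pi) (e : E) : set (garr Pi) :=
  coset p (trm (abs_edge e)) (gg_H GG (abs_edge e)).

(* Vertices p G_v [v] and edges p H_|e| [e]: cosets together with their tag. *)
Definition bs_vert : Type :=
  {a : V * set (garr Pi) | exists p, a.2 = vcoset p a.1}.

Definition bs_edge : Type :=
  {a : E * set (garr Pi) | exists p, a.2 = ecoset p a.1}.

Definition bs_vert_of (p : garr Pi) (v : V) : bs_vert :=
  exist _ (v, vcoset p v) (ex_intro _ p erefl).

Definition bs_edge_of (p : garr Pi) (e : E) : bs_edge :=
  exist _ (e, ecoset p e) (ex_intro _ p erefl).

Definition bs_tag (a : bs_edge) : E := (sval a).1.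

Definition bs_rep (a : bs_edge) : garr Pi := sval (cid (svalP a)).

Lemma bs_repP a : a = bs_edge_of (bs_rep a) (bs_tag a).
Proof.
apply: sval_inj; rewrite /= /bs_tag /bs_rep; case: cid => /= p <-.
by case: (sval a).
Qed.

(* The endpoints are computed from a chosen representative p; by [org_bs_edge]
   and [trm_bs_edge] below they do not depend on it. *)
Definition bs_org (a : bs_edge) : bs_vert :=
  let p := bs_rep a in let e := bs_tag a in
  bs_vert_of (if `[< pos e >] then pi1_mul_edge p e else p) (org e).

Definition bs_trm (a : bs_edge) : bs_vert :=
  let p := bs_rep a in let e := bs_tag a in
  bs_vert_of (if `[< pos e >] then p else pi1_mul_edge p (bar e)) (trm e).

Lemma bs_bar_subproof (a : bs_edge) : exists p, (sval a).2 = ecoset p (bar (bs_tag a)).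
Proof.
by case: (svalP a) => p pE; exists p; rewrite pE /ecoset abs_edge_bar.
Qed.

Definition bs_bar (a : bs_edge) : bs_edge :=
  exist _ (bar (bs_tag a), (sval a).2) (bs_bar_subproof a).

Lemma bs_bar_of p e : bs_bar (bs_edge_of p e) = bs_edge_of p (bar e).
Proof. by apply: sval_inj; rewrite /= /ecoset abs_edge_bar. Qed.

(* Each endpoint of p H_|e| [e] is independent of the representative p. *)

Lemma tau_inj v y y' : Gv0 v y -> Gv0 v y' -> tau v y = tau v y' -> y = y'.
Proof.
move=> vy vy' tyy'; have e1 := tau_equiv vy; have e2 := tau_equiv vy'.
rewrite -tyy' in e2.
have /equiv_path[_ /(_ vy)[p /= hp <-]] : tree_equiv (v, y) (v, y').
  by apply: rst_trans e1 _; apply: rst_sym.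
by rewrite (holonomy hp).
Qed.

Lemma pi1_vert_irr v g (h h' : gg_vert GG v g) : pi1_vert h = pi1_vert h'.
Proof. by congr pi1_vert; apply: Prop_irrelevance. Qed.

Lemma pi1_vertM v g h (vg : gg_vert GG v g) (vh : gg_vert GG v h)
    (vgh : gg_vert GG v (gmul g h)) : gsrc g = grng h ->
  gmul (pi1_vert vg) (pi1_vert vh) = pi1_vert vgh.
Proof.
move=> gh; have w := pi1_relP (rel_vert_mul vg vh gh).
have wm : wwf (Gv0 r) is_gen gen_rng gen_src (Wmul (wv v g) (wv v h)) by case: w.
rewrite [LHS](@pa_mulE pi1_presentation _ _ _ _ wm).
exact/pr_clsE/(@weq_rel pi1_presentation)/rel_vert_mul.
Qed.

Lemma pi1_vert1 v y (vy : Gv0 v y) (p : garr Pi) :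
  sval (gsrc p) = tau v y -> gmul p (pi1_vert vy) = p.
Proof.
move=> py; rewrite -[RHS]gmulg1; congr gmul.
apply/pr_clsE; move: py => /= ->.
exact/(@weq_rel pi1_presentation)/rel_vert_id.
Qed.

Lemma vcoset_eq v (p : garr Pi) k (vk : gg_vert GG v k) :
  sval (gsrc p) = tau v (grng k) -> vcoset (gmul p (pi1_vert vk)) v = vcoset p v.
Proof.
move=> pk; have sG := gg_vert_sub GG v.
have pc : gsrc p = grng (pi1_vert vk).
  by apply: sval_inj; rewrite pk grng_pi1_vert.
apply/seteqP; split=> q [h [vh [_]]].
  rewrite gsrc_mul // gsrc_pi1_vert => /tau_inj kh ->.
  have {}kh : gsrc k = grng h.
    by apply: kh; [apply: (subgroupoid_src sG vk) | apply: (subgroupoid_rng sG vh)].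
  have vkh := sG.2 _ _ vk vh kh.
  exists (gmul k h), vkh; split=> //; first by rewrite grng_mul.
  rewrite -gmulA ?pi1_vertM //.
  by apply: sval_inj; rewrite grng_pi1_vert gsrc_pi1_vert kh.
move=> ph ->; have kh : grng k = grng h.
  apply: (@tau_inj v); rewrite -?pk //; first exact: (subgroupoid_rng sG vk).
  exact: (subgroupoid_rng sG vh).
have vi := sG.1 _ vk; have ih : gsrc (ginv k) = grng h by rewrite gsrc_inv.
have vih := sG.2 _ _ vi vh ih.
exists (gmul (ginv k) h), vih; split=> //.
  by rewrite gsrc_mul // gsrc_pi1_vert grng_mul // grng_inv.
have vkih : gg_vert GG v (gmul k (gmul (ginv k) h)).
  by apply: sG.2 => //; rewrite grng_mul // grng_inv.
rewrite -gmulA //; last first.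
  by apply: sval_inj; rewrite grng_pi1_vert gsrc_pi1_vert grng_mul // grng_inv.
rewrite (pi1_vertM _ _ vkih) ?grng_mul ?grng_inv //.
congr gmul; apply/pr_clsE; rewrite gmulA ?grng_inv // gmulgV kh gmul1g.
exact: (@weq_refl pi1_presentation).
Qed.

Lemma pi1_edge_irr e x x' (ex : Gv0 (org e) x) (ex' : Gv0 (org e) x') :
  x = x' -> pi1_edge ex = pi1_edge ex'.
Proof. by move=> xx'; subst x'; congr pi1_edge; apply: Prop_irrelevance. Qed.

Lemma pi1_mul_edgeE (p : garr Pi) e y (ey : Gv0 (org e) y) :
  tau (trm e) (phi0 GG e y) = sval (gsrc p) -> pi1_mul_edge p e = gmul p (pi1_edge ey).
Proof.
move=> yp; rewrite /pi1_mul_edge; congr gmul; apply: pi1_edge_irr.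
case: cid => z /= [ez zp].
rewrite -(phi0_barK wG ez) -(phi0_barK wG ey); congr phi0.
by apply: (@tau_inj (trm e)); rewrite ?yp //; apply: phi0_unit.
Qed.

Lemma pi1_edgeV e x (ex : Gv0 (org e) x) (ex' : Gv0 (org (bar e)) (phi0 GG e x)) :
  ginv (pi1_edge ex) = pi1_edge ex'.
Proof.
rewrite [LHS](@pa_invE pi1_presentation (we e x) ex ex).
exact/pr_clsE/(@weq_rel pi1_presentation)/rel_edge_inv.
Qed.

(* (phi_e(x), x) alpha_(bar e)(g) = alpha_e(g) (phi_e(y), y), where x and y are
   the images under alpha_(bar e) of r(g) and s(g). *)
Lemma pi1_edge_comm e g (eg : gg_edge GG e g)
    (xr : Gv0 (org e) (alpha0 GG (bar e) (grng g)))
    (xs : Gv0 (org e) (alpha0 GG (bar e) (gsrc g)))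
    (va : gg_vert GG (org e) (gg_alpha GG (bar e) g))
    (vb : gg_vert GG (trm e) (gg_alpha GG e g)) :
  gmul (pi1_edge xr) (pi1_vert va) = gmul (pi1_vert vb) (pi1_edge xs).
Proof.
have ur := subgroupoid_rng (gg_edge_sub GG e) eg.
have us := subgroupoid_src (gg_edge_sub GG e) eg.
have eg' : gg_edge GG (bar e) g by rewrite gg_edge_bar.
have phs : phi0 GG e (alpha0 GG (bar e) (gsrc g)) = alpha0 GG e (gsrc g).
  exact: phi0_alpha0.
have zs : Gv0 (org (bar e)) (alpha0 GG e (gsrc g)).
  by rewrite org_bar; apply: alpha0_unit.
have c1 : gsrc (pi1_edge xr) = grng (pi1_vert va).
  by apply: sval_inj; rewrite gsrc_pi1_edge grng_pi1_vert grng_alpha.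
have c2 : gsrc (pi1_vert va) = grng (pi1_edge zs).
  apply: sval_inj; rewrite gsrc_pi1_vert grng_pi1_edge gsrc_alpha // trm_bar.
  by rewrite -[in RHS]phs phi0_barK.
have c3 : gsrc (pi1_edge zs) = grng (pi1_edge xs).
  by apply: sval_inj; rewrite gsrc_pi1_edge grng_pi1_edge phs org_bar.
have -> : pi1_vert vb = gmul (gmul (pi1_edge xr) (pi1_vert va)) (pi1_edge zs).
  have [w1 w2 _ _] := pi1_relP (rel_R2 eg).
  have w3 : wwf (Gv0 r) is_gen gen_rng gen_src
      (Wmul (we e (alpha0 GG (bar e) (grng g)))
            (wv (org e) (gg_alpha GG (bar e) g))) by case: w1.
  rewrite [gmul (pi1_edge xr) _](@pa_mulE pi1_presentation _ _ _ _ w3).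
  rewrite [RHS](@pa_mulE pi1_presentation _ _ _ _ w1).
  exact/pr_clsE/(@weq_sym pi1_presentation)/(@weq_rel pi1_presentation)/rel_R2.
have xs' : Gv0 (org (bar e)) (phi0 GG e (alpha0 GG (bar e) (gsrc g))).
  by rewrite phs.
have zsE : pi1_edge zs = ginv (pi1_edge xs).
  by rewrite (pi1_edgeV xs xs'); apply: pi1_edge_irr.
have c4 : gsrc (pi1_edge xs) = gsrc (gmul (pi1_edge xr) (pi1_vert va)).
  apply: sval_inj.
  by rewrite gsrc_mul // gsrc_pi1_edge gsrc_pi1_vert gsrc_alpha.
by rewrite -[in RHS]gmulA ?gsrc_mul // zsE gmulVg c4 gmulg1.
Qed.

Lemma ecoset_vcoset (p q : garr Pi) (e : E) :
  coset p (trm e) (gg_H GG e) q ->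
  vcoset q (trm e) = vcoset p (trm e) /\
  vcoset (pi1_mul_edge q e) (org e) = vcoset (pi1_mul_edge p e) (org e).
Proof.
move=> [k [vk [[g eg gk] pk ->]]]; subst k; split; first exact: vcoset_eq.
have ur := subgroupoid_rng (gg_edge_sub GG e) eg.
have us := subgroupoid_src (gg_edge_sub GG e) eg.
have eg' : gg_edge GG (bar e) g by rewrite gg_edge_bar.
have xr := alpha0_bar_unit ur; have xs := alpha0_bar_unit us.
have va : gg_vert GG (org e) (gg_alpha GG (bar e) g).
  by rewrite -trm_bar; apply: gg_alpha_in.
have pc : gsrc p = grng (pi1_vert vk).
  by apply: sval_inj; rewrite pk grng_pi1_vert.
have pr : tau (trm e) (phi0 GG e (alpha0 GG (bar e) (grng g))) = sval (gsrc p).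
  by rewrite pk phi0_alpha0 // grng_alpha.
have c1 : gsrc (pi1_vert vk) = grng (pi1_edge xs).
  apply: sval_inj.
  by rewrite gsrc_pi1_vert grng_pi1_edge phi0_alpha0 // gsrc_alpha.
have c2 : gsrc p = grng (pi1_edge xr).
  by apply: sval_inj; rewrite grng_pi1_edge pr.
have c3 : gsrc (pi1_edge xr) = grng (pi1_vert va).
  by apply: sval_inj; rewrite gsrc_pi1_edge grng_pi1_vert grng_alpha.
rewrite (pi1_mul_edgeE xr pr) (pi1_mul_edgeE xs); last first.
  by rewrite gsrc_mul // c1 grng_pi1_edge.
rewrite -gmulA // -(pi1_edge_comm eg xr xs va) gmulA //.
by apply: vcoset_eq; rewrite gsrc_mul // c3 grng_pi1_vert.
Qed.

Lemma ecoset_mem (p : garr Pi) (e : E) : ecoset p e p.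
Proof.
have [y vy py] := tau_surj (trm (abs_edge e)) (svalP (gsrc p)).
have [x ex xy] := wide_unit wG vy.
exists (gid y), vy; rewrite grng_id; split=> //; last by rewrite pi1_vert1.
by exists (gid x) => //; rewrite gg_alpha_id // -xy.
Qed.

Lemma bs_rep_coset (p : garr Pi) (e : E) : ecoset p e (bs_rep (bs_edge_of p e)).
Proof.
rewrite /bs_rep; case: cid => q /= ->; exact: ecoset_mem.
Qed.

Lemma org_bs_edge (p : garr Pi) (e : E) : bs_org (bs_edge_of p e) =
  bs_vert_of (if `[< pos e >] then pi1_mul_edge p e else p) (org e).
Proof.
apply: sval_inj; rewrite /bs_org /=; congr (_, _).
have := bs_rep_coset p e; rewrite /ecoset /bs_tag /=.
move: (bs_rep _) => q; rewrite /abs_edge; case: asboolP => _ /ecoset_vcoset[].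
  by [].
by rewrite trm_bar.
Qed.

Lemma trm_bs_edge (p : garr Pi) (e : E) : bs_trm (bs_edge_of p e) =
  bs_vert_of (if `[< pos e >] then p else pi1_mul_edge p (bar e)) (trm e).
Proof.
apply: sval_inj; rewrite /bs_trm /=; congr (_, _).
have := bs_rep_coset p e; rewrite /ecoset /bs_tag /=.
move: (bs_rep _) => q; rewrite /abs_edge; case: asboolP => _ /ecoset_vcoset[].
  by [].
by rewrite org_bar.
Qed.

Lemma bs_bar_neq a : bs_bar a <> a.
Proof. by move=> /(congr1 bs_tag); apply: bar_neq. Qed.

Lemma bs_barK a : bs_bar (bs_bar a) = a.
Proof. by rewrite (bs_repP a) !bs_bar_of barK. Qed.

Lemma bs_trm_bar a : bs_trm (bs_bar a) = bs_org a.
Proof.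
rewrite (bs_repP a) bs_bar_of trm_bs_edge org_bs_edge pos_bar barK trm_bar.
by case: asboolP.
Qed.

Definition bass_serre_forest : graph := Graph bs_bar_neq bs_barK bs_trm_bar.

End Fundamental.

Definition bar_set (F : graph) (P : set (edge F)) : set (edge F) :=
  [set bar f | f in P].

Record desingularization (G : groupoid) (F : graph) (A : action G F) :=
  Desingularization {
  d_graph : graph;
  d_tree : maximal_subtree d_graph;
  d_root : vert d_graph;

  d_pos : set (edge d_graph);
  d_treepos : set (edge d_graph);
  d_upos : set (edge d_graph);
  d_pos_orient : orientation setT d_pos;
  d_treepos_orient : orientation (sub_edge d_tree) d_treepos;
  d_posU : d_pos = d_treepos `|` d_upos;
  d_upos_tree : d_upos `&` sub_edge d_tree = set0;

  d_XV : vert d_graph -> set (gobj G);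
  d_sigV : vert d_graph -> gobj G -> vert F;
  d_sigV_section : forall v, sectionV A (d_XV v) (d_sigV v);
  d_XE : edge d_graph -> set (gobj G);
  d_sigE : edge d_graph -> gobj G -> edge F;
  d_sigE_section : forall e, sectionE A (d_XE e) (d_sigE e);
  d_XE_bar : forall e, d_XE (bar e) = d_XE e;
  d_sigE_bar : forall e x, d_XE e x -> d_sigE (bar e) x = bar (d_sigE e x);
  (* g_(e,x), of interest for e in Upsilon_- and x in X_e only *)
  d_g : edge d_graph -> gobj G -> garr G;

  d_XV_root : d_XV d_root = setT;
  d_satV_disj : trivIset setT (fun v => satV A (d_sigV v @` d_XV v));
  d_satV_cover : \bigcup_v satV A (d_sigV v @` d_XV v) = setT;

  d_tree_dom : forall e, sub_edge d_tree e ->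
    d_XE e `<=` d_XV (org e) `&` d_XV (trm e);
  d_tree_ends : forall e x, sub_edge d_tree e -> d_XE e x ->
    org (d_sigE e x) = d_sigV (org e) x /\ trm (d_sigE e x) = d_sigV (trm e) x;
  d_tree_path : forall v x (p : seq (edge d_tree)), d_XV v x ->
    gpath (tvtx d_tree d_root) p (tvtx d_tree v) -> reduced p ->
    forall e, List.In e p -> d_XE (sval e) x;

  d_uneg_ends : forall e x, bar_set d_upos e -> d_XE e x ->
    [/\ d_XV (org e) x, org (d_sigE e x) = d_sigV (org e) x,
        gsrc (d_g e x) = x &
        (d_sigV (trm e) @` d_XV (trm e)) (actV A (d_g e x) (trm (d_sigE e x)))];

  d_satE_disj : trivIset setT (fun e => satE A (d_sigE e @` d_XE e));
  d_satE_cover : \bigcup_e satE A (d_sigE e @` d_XE e) = setT;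

  d_gog : graph_of_groupoids d_graph G;
  d_gog_vert : forall v, gg_vert d_gog v = stabV A (d_XV v) (d_sigV v);
  d_gog_edge : forall e, gg_edge d_gog e = stabE A (d_XE e) (d_sigE e);
  d_gog_incl : forall e k, (sub_edge d_tree `|` d_upos) e -> gg_edge d_gog e k ->
    gg_alpha d_gog e k = k;
  d_gog_conj : forall e k, bar_set d_upos e -> gg_edge d_gog e k ->
    gg_alpha d_gog e k =
    gmul (gmul (d_g e (grng k)) k) (ginv (d_g e (gsrc k)))
}.

Arguments d_XV {G F A} d v _.
Arguments d_sigV {G F A} d v x.
Arguments d_XE {G F A} d e _.
Arguments d_sigE {G F A} d e x.
Arguments d_upos {G F A} d _.
Arguments d_pos {G F A} d _.
Arguments d_g {G F A} d e x.

Section MainMaps.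
Variables (G : groupoid) (F : graph) (A : action G F).
Variable D : desingularization A.

(* The family g_(e,y) for all edges e: for e in Upsilon_+ it is the inverse of
   g_(bar e, x), where y = r(g_(bar e, x)). *)
Definition g_ext (e : edge (d_graph D)) (y : gobj G) : garr G :=
  if `[< sub_edge (d_tree D) e >] then gid y
  else if `[< bar_set (d_upos D) e >] then d_g D e y
  else ginv (d_g D (bar e)
    (choose_in y [set x | d_XE D (bar e) x /\ grng (d_g D (bar e) x) = y])).

Hypothesis wD : wide (d_gog D).

Definition pi1 : groupoid := fundamental_groupoid wD (d_tree D) (d_root D).

Definition bsf : graph :=
  bass_serre_forest wD (d_tree D) (d_root D) (d_pos_orient D).

Definition is_psi (psi : groupoid_hom pi1 G) : Prop :=
  (forall v g (vg : gg_vert (d_gog D) v g),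
     psi (pi1_vert wD (d_tree D) (d_root D) vg) = g) /\
  (forall e x (ex : units (gg_vert (d_gog D) (org e)) x),
     psi (pi1_edge wD (d_tree D) (d_root D) ex) = g_ext e x).

Definition is_Psi (psi : groupoid_hom pi1 G) (Psi : graph_hom bsf F) : Prop :=
  (forall (p : garr pi1) v,
     hom_vert Psi (bs_vert_of p v) =
     actV A (psi p) (d_sigV D v (hom_obj psi (gsrc p)))) /\
  (forall (p : garr pi1) e,
     hom_edge Psi (bs_edge_of (d_pos D) p e) =
     actE A (psi p) (d_sigE D e (hom_obj psi (gsrc p)))).

End MainMaps.

(* Main.v *)
Require Import Defs.
From mathcomp Require Import all_boot.
From mathcomp Require Import boolp classical_sets.

(** Wideness makes every X_v and X_e equal to the whole unit space of G, so
    that tau is the identity on units and H_|e| is the stabilizer of sigma_e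
    ([XV_full], [tau_id], [H_abs]).  The elements g_(e,x) then satisfy the
    relations of the fundamental groupoid ([g_extV], [g_ext_comm]), which gives
    psi, and they carry the chosen lifts of vertices to the actual origins of
    the chosen lifts of edges ([org_sigE]), which makes Psi a graph
    homomorphism.

    Bijectivity is the argument of classical Bass-Serre theory, fiber by fiber.
    Since the vertex groupoids are full stabilizers of sections, and since
    translates of distinct sections never meet, Psi maps the star of each vertex
    bijectively onto the star of its image ([Psi_star_inj],
    [Psi_star_surj]).  Two cosets whose images lie in the same fiber of F can be
    joined by a path, because a product of generators can be undone one
    generator at a time ([linked_fiber]).  A locally injective map from a
    connected graph to a tree is injective: a closed path in the tree backtracks,
    and the backtracking lifts ([immersion_tree_inj]).  A locally surjective map
    to a connected graph is surjective, by lifting paths ([path_lifting]).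
    Hence Psi is bijective.  The forest structure of the Bass-Serre graph is not
    established beforehand; it is a consequence.

    The bijectivity of psi is read off from that of Psi at the root.  If
    psi(p) = psi(q) then p G_r and q G_r have the same image, so that q = p k
    with k in G_r and psi(k) a unit, but psi(k) = k.  Given g in G, the vertex
    g.sigma_r(s(g)) is the image of some p G_v; disjointness of the saturations
    gives v = r, and psi(p)^-1 g stabilizes sigma_r, so it lies in G_r and
    in the image of psi. *)

Set Implicit Arguments.
Unset Strict Implicit.
Unset Printing Implicit Defensive.

Local Open Scope classical_set_scope.

(** * Groupoids and their homomorphisms *)

Section GroupoidFacts.
Variable G : groupoid.
Implicit Types g h k : garr G.

Lemma gmulKg g h : gsrc g = grng h -> gmul (ginv g) (gmul g h) = h.
Proof. by move=> gh; rewrite gmulA ?gsrc_inv // gmulVg gh gmul1g. Qed.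

Lemma gmulVKg g h : grng g = grng h -> gmul g (gmul (ginv g) h) = h.
Proof. by move=> gh; rewrite gmulA ?gsrc_inv ?grng_inv // gmulgV gh gmul1g. Qed.

Lemma gmulgK g h : gsrc g = grng h -> gmul (gmul g h) (ginv h) = g.
Proof. by move=> gh; rewrite -gmulA ?grng_inv // gmulgV -gh gmulg1. Qed.

Lemma gmulgVK g h : gsrc g = gsrc h -> gmul (gmul g (ginv h)) h = g.
Proof. by move=> gh; rewrite -gmulA ?gsrc_inv ?grng_inv // gmulVg -gh gmulg1. Qed.

Lemma ginvK g : ginv (ginv g) = g.
Proof.
rewrite -[LHS]gmulg1 gsrc_inv grng_inv -gmulVg.
by rewrite gmulKg // gsrc_inv.
Qed.

Lemma ginv_id x : ginv (gid x) = gid x :> garr G.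
Proof.
have e := gmulVg (gid x); rewrite gsrc_id in e.
by rewrite -[LHS]gmulg1 gsrc_inv grng_id.
Qed.

Lemma gmulIg k g h : gsrc g = grng k -> gsrc h = grng k ->
  gmul g k = gmul h k -> g = h.
Proof. by move=> gk hk /(congr1 (fun u => gmul u (ginv k))); rewrite !gmulgK. Qed.

Lemma gmulgI k g h : gsrc k = grng g -> gsrc k = grng h ->
  gmul k g = gmul k h -> g = h.
Proof. by move=> gk hk /(congr1 (gmul (ginv k))); rewrite !gmulKg. Qed.

End GroupoidFacts.

Section Homomorphisms.
Variables G H : groupoid.

Lemma hom_id (f : groupoid_hom G H) x : f (gid x) = gid (hom_obj f x).
Proof.
have e : gsrc (gid x) = grng (gid x) by rewrite gsrc_id grng_id.
rewrite -[in RHS](grng_id x) -hom_rng; apply: gidem.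
  by rewrite hom_src hom_rng e.
by rewrite -hom_mul //; congr (f _); rewrite -{1}[x]grng_id gmul1g.
Qed.

Lemma groupoid_hom_eq (f f' : groupoid_hom G H) : f =1 f' -> f = f'.
Proof.
move=> ff'; have oo : hom_obj f = hom_obj f'.
  by apply: funext => x; rewrite -[x]grng_id -!hom_rng ff'.
have {}ff' : hom_arr f = hom_arr f' by apply: funext.
case: f f' oo ff' => fo fa r1 s1 m1 [fo' fa' r2 s2 m2] /= oo aa.
by subst fo' fa'; congr GroupoidHom; apply: Prop_irrelevance.
Qed.

(** Objects need no separate hypothesis: they are recovered from their unit
    arrows. *)
Lemma bij_groupoid_iso (f : groupoid_hom G H) :
  injective f -> (forall h, exists g, f g = h) -> groupoid_iso f.
Proof.
move=> fI /choice[f' f'K]; have fK : cancel f f' by move=> g; apply/fI/f'K.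
pose o' y := grng (f' (gid y)).
have oK : cancel (hom_obj f) o' by move=> x; rewrite /o' -hom_id fK grng_id.
have o'K : cancel o' (hom_obj f) by move=> y; rewrite /o' -hom_rng f'K grng_id.
have rng' h : grng (f' h) = o' (grng h) by rewrite -{2}(f'K h) hom_rng oK.
have src' h : gsrc (f' h) = o' (gsrc h) by rewrite -{2}(f'K h) hom_src oK.
have mul' g h : gsrc g = grng h -> f' (gmul g h) = gmul (f' g) (f' h).
  by move=> gh; apply: fI; rewrite hom_mul ?f'K // src' rng' gh.
by exists (GroupoidHom rng' src' mul').
Qed.

End Homomorphisms.

(** * Universal property and induction for presented groupoids *)

Section PresentedHom.
Variables (P : presentation) (H : groupoid).
Variables (f0 : pr_base P -> gobj H) (f1 : pr_sym P -> garr H).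
Local Notation word := (word (pr_base P) (pr_sym P)).
Local Notation wrng := (@wrng (pr_base P) (pr_sym P) (@pr_rng P) (@pr_src P)).
Local Notation wsrc := (@wsrc (pr_base P) (pr_sym P) (@pr_rng P) (@pr_src P)).
Local Notation wwf := (wwf (@pr_unit P) (@pr_gen P) (@pr_rng P) (@pr_src P)).

Fixpoint weval (t : word) : garr H :=
  match t with
  | Wid x => gid (f0 x)
  | Wgen a => f1 a
  | Winv t => ginv (weval t)
  | Wmul t u => gmul (weval t) (weval u)
  end.

Hypothesis f1_ends : forall a, pr_gen a ->
  grng (f1 a) = f0 (pr_rng a) /\ gsrc (f1 a) = f0 (pr_src a).
Hypothesis f1_rel : forall t u, pr_rel t u -> weval t = weval u.

Lemma weval_ends t : wwf t ->
  grng (weval t) = f0 (wrng t) /\ gsrc (weval t) = f0 (wsrc t).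
Proof.
elim: t => [x|a|t IH|t IHt u IHu] /=; first by rewrite grng_id gsrc_id.
- exact: f1_ends.
- by rewrite grng_inv gsrc_inv => /IH[-> ->].
- move=> [/IHt[rt st] /IHu[ru su] tu].
  by rewrite grng_mul ?gsrc_mul ?rt ?su // st ru tu.
Qed.

Lemma weval_weq t u : weq t u -> weval t = weval u.
Proof.
elim=> {t u} //=.
- by move=> t u w _ -> _ ->.
- by move=> t u _ ->.
- by move=> t t' u u' _ _ -> _ ->.
- move=> t u w /weval_ends[_ st] /weval_ends[ru su] /weval_ends[rw _] tu uw.
  by rewrite gmulA ?st ?ru ?su ?rw ?tu ?uw.
- by move=> t /weval_ends[<- _]; rewrite gmul1g.
- by move=> t /weval_ends[_ <-]; rewrite gmulg1.
- by move=> t /weval_ends[_ <-]; rewrite gmulVg.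
- by move=> t /weval_ends[<- _]; rewrite gmulgV.
Qed.

Definition pres_arr (a : pr_arr P) : garr H := weval (pr_repr a).

Lemma pres_arrE t (wt : wwf t) : pres_arr (pr_cls wt) = weval t.
Proof. exact/weval_weq/pr_cls_repr. Qed.

Lemma pres_rng (a : garr (presented_groupoid P)) :
  grng (pres_arr a) = f0 (sval (grng a)).
Proof. exact: (weval_ends (pr_reprP a)).1. Qed.

Lemma pres_src (a : garr (presented_groupoid P)) :
  gsrc (pres_arr a) = f0 (sval (gsrc a)).
Proof. exact: (weval_ends (pr_reprP a)).2. Qed.

Lemma pres_mul (a b : garr (presented_groupoid P)) : gsrc a = grng b ->
  pres_arr (gmul a b) = gmul (pres_arr a) (pres_arr b).
Proof.
elim/pr_ind: a => t wt; elim/pr_ind: b => u wu /pa_comp tu.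
have wtu : wwf (Wmul t u) by [].
by rewrite [gmul _ _](pa_mulE _ _ wtu) !pres_arrE.
Qed.

Definition pres_hom : groupoid_hom (presented_groupoid P) H :=
  @GroupoidHom (presented_groupoid P) H (fun x => f0 (sval x)) pres_arr
    pres_rng pres_src pres_mul.

End PresentedHom.

Section PresentedInd.
Variables (P : presentation) (Q : garr (presented_groupoid P) -> Prop).
Hypothesis Q_id : forall x, Q (gid x).
Hypothesis Q_gen : forall a
  (wa : wwf (@pr_unit P) (@pr_gen P) (@pr_rng P) (@pr_src P) (Wgen a)),
  Q (pr_cls wa).
Hypothesis Q_inv : forall p, Q p -> Q (ginv p).
Hypothesis Q_mul : forall p q, gsrc p = grng q -> Q p -> Q q -> Q (gmul p q).

Lemma presented_ind p : Q p.
Proof.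
elim/pr_ind: p => t; elim: t => [x|a|t IH|t IHt u IHu] wt.
- by rewrite -(@pa_idE P (exist _ x wt) wt); apply: Q_id.
- exact: Q_gen.
- by rewrite -(@pa_invE P t wt wt); apply/Q_inv/IH.
- have [wt' wu tu] := wt; rewrite -(pa_mulE wt' wu wt).
  by apply: Q_mul => //; apply/pa_comp.
Qed.

End PresentedInd.

(** * Local injectivity, local surjectivity and path lifting *)

Section GraphMaps.
Variables X Y : graph.

Lemma graph_hom_eq (f f' : graph_hom X Y) :
  hom_vert f =1 hom_vert f' -> hom_edge f =1 hom_edge f' -> f = f'.
Proof.
move=> /funext vv /funext ee.
case: f f' vv ee => fv fe o1 t1 b1 [fv' fe' o2 t2 b2] /= vv ee.
by subst fv' fe'; congr GraphHom; apply: Prop_irrelevance.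
Qed.

Lemma bij_graph_iso (f : graph_hom X Y) :
  injective (hom_vert f) -> (forall w, exists v, hom_vert f v = w) ->
  injective (hom_edge f) -> (forall e, exists a, hom_edge f a = e) ->
  graph_iso f.
Proof.
move=> vI /choice[v' v'K] eI /choice[e' e'K].
have vK : cancel (hom_vert f) v' by move=> v; apply: vI.
have eK : cancel (hom_edge f) e' by move=> e; apply: eI.
have org' e : org (e' e) = v' (org e) by rewrite -{2}(e'K e) hom_org vK.
have trm' e : trm (e' e) = v' (trm e) by rewrite -{2}(e'K e) hom_trm vK.
have bar' e : bar (e' e) = e' (bar e) by rewrite -{2}(e'K e) hom_bar eK.
by exists (GraphHom org' trm' bar').
Qed.

Definition linked (y x : vert X) : Prop := exists p, gpath y p x.

Lemma linked_refl x : linked x x.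
Proof. by exists [::]. Qed.

Lemma linked_sym y x : linked y x -> linked x y.
Proof. by case=> p /gpath_rev; exists (Defs.rev_path p). Qed.

Lemma linked_trans y x z : linked x y -> linked y z -> linked x z.
Proof. by move=> [p hp] [q hq]; exists (p ++ q); apply/gpath_cat; exists y. Qed.

Lemma linked_edge (a : edge X) : linked (org a) (trm a).
Proof. by exists [:: bar a] => /=; rewrite trm_bar org_bar. Qed.

Variable f : graph_hom X Y.

Lemma gpath_map y p x : gpath y p x ->
  gpath (hom_vert f y) (map (hom_edge f) p) (hom_vert f x).
Proof.
elim: p y => [|a p IH] y /= => [->//|[<- /IH h]].
by rewrite hom_trm hom_org.
Qed.

Hypothesis star_inj : forall a b, org a = org b ->
  hom_edge f a = hom_edge f b -> a = b.

(** A path from y to x maps to a closed path, which backtracks unless it is empty.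
    By local injectivity each backtracking of the image is a backtracking of the
    path itself, so the path can be shortened until it is empty. *)
Lemma immersion_tree_inj x y :
  (forall p, gpath (hom_vert f x) p (hom_vert f x) -> reduced p -> p = [::]) ->
  linked y x -> hom_vert f y = hom_vert f x -> y = x.
Proof.
move=> red [p]; have [n] := ubnP (size p); elim: n p => // n IH p sp hp yx.
case: (pselect (reduced (map (hom_edge f) p))) => [rp|].
  have := gpath_map hp; rewrite yx => /red/(_ rp).
  by case: p hp {sp rp}.
move=> /not_reduced[q1 [e [q2 pE]]].
have [p1 [a [b [p2 [{}pE ab]]]]] : exists p1 a b p2,
    p = p1 ++ a :: b :: p2 /\ hom_edge f b = bar (hom_edge f a).
  elim: p q1 pE {hp sp} => [|a p IHp] [|e1 q1] //= [aE].
    by case: p {IHp} => [|b p2] //= [bE _]; exists [::], a, b, p2; rewrite aE.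
  by move=> /IHp[p1 [a' [b [p2 [-> h]]]]]; exists (a :: p1), a', b, p2.
move: hp sp; rewrite {}pE => /gpath_cat[z [h1 [/= az [bz h2]]]] sp.
have bE : b = bar a.
  have /(congr1 (@bar X)) : bar b = a; last by rewrite barK.
  apply: star_inj; first by rewrite org_bar.
  by rewrite -hom_bar ab barK.
apply: (IH (p1 ++ p2)) => //.
  by move: sp; rewrite !size_cat /= !addnS ltnS => /ltnW.
by apply/gpath_cat; exists z; split=> //; rewrite -az -[trm a]org_bar -bE.
Qed.

Hypothesis star_surj : forall v e, org e = hom_vert f v ->
  exists2 a, org a = v & hom_edge f a = e.

Lemma path_lifting w p v : gpath w p (hom_vert f v) ->
  exists2 u, linked u v & hom_vert f u = w.
Proof.
elim: p w => [|e p IH] w /=.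
  by move=> ->; exists v => //; apply: linked_refl.
case=> <- /IH[u uv /esym /star_surj[a au <-]]; exists (trm a);
  last by rewrite hom_trm.
by apply: linked_trans uv; rewrite -au; apply/linked_sym/linked_edge.
Qed.

End GraphMaps.

(** * Groupoid actions on graphs whose fibers are trees *)

Section ActionFacts.
Variables (G : groupoid) (F : graph) (A : action G F).

Lemma actVM g h v : gsrc g = grng h -> gsrc h = mom A v ->
  actV A (gmul g h) v = actV A g (actV A h v).
Proof. by move=> gh hv; rewrite actV_mul. Qed.

Lemma actEM g h e : gsrc g = grng h -> gsrc h = momE A e ->
  actE A (gmul g h) e = actE A g (actE A h e).
Proof. by move=> gh he; rewrite actE_mul. Qed.

Lemma actVK g v : gsrc g = mom A v -> actV A (ginv g) (actV A g v) = v.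
Proof. by move=> gv; rewrite actV_mul ?gsrc_inv // gmulVg gv actV_id. Qed.

Lemma actEK g e : gsrc g = momE A e -> actE A (ginv g) (actE A g e) = e.
Proof. by move=> ge; rewrite actE_mul ?gsrc_inv // gmulVg ge actE_id. Qed.

Lemma momE_bar e : momE A (bar e) = momE A e.
Proof. by rewrite /momE trm_bar mom_org. Qed.

Lemma stabV_quot dom sig g h : sectionV A dom sig ->
  dom (gsrc g) -> dom (gsrc h) -> grng g = grng h ->
  actV A g (sig (gsrc g)) = actV A h (sig (gsrc h)) ->
  stabV A dom sig (gmul (ginv g) h).
Proof.
move=> sec dg dh gh e.
have c : gsrc (ginv g) = grng h by rewrite gsrc_inv.
split; rewrite ?gsrc_mul ?grng_mul ?grng_inv //.
by rewrite actVM ?sec // -e actVK ?sec.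
Qed.

Lemma stabE_quot dom sig g h : sectionE A dom sig ->
  dom (gsrc g) -> dom (gsrc h) -> grng g = grng h ->
  actE A g (sig (gsrc g)) = actE A h (sig (gsrc h)) ->
  stabE A dom sig (gmul (ginv g) h).
Proof.
move=> sec dg dh gh e.
have c : gsrc (ginv g) = grng h by rewrite gsrc_inv.
split; rewrite ?gsrc_mul ?grng_mul ?grng_inv //.
by rewrite actEM ?sec // -e actEK ?sec.
Qed.

Hypothesis treeF : forall x : gobj G, is_tree (fiber A x).

(** A path in F stays in the fiber of its endpoint, since the momentum is
    constant along edges. *)
Lemma fiber_path x (y z : vert (fiber A x)) p : gpath (sval y) p (sval z) ->
  exists2 q, gpath y q z & map (@sval _ _) q = p.
Proof.
elim: p y => [|e p IH] y /=.
  by move=> /(@sval_inj _ _ _ _) <-; exists [::].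
move=> [ey hp]; have xe : sub_edge (fiber A x) e.
  by rewrite /= /fib_edge /= /momE ey; exact: (svalP y).
have [q hq <-] := IH (org (exist _ e xe : edge (fiber A x))) hp.
by exists (exist _ e xe :: q) => //; split=> //; apply: sval_inj.
Qed.

Lemma reduced_sval (S : subgraph F) (q : seq (edge S)) :
  reduced (map (@sval _ _) q) -> reduced q.
Proof.
elim: q => [|a q IH] //= [h rq]; split; last exact: IH.
by case: q h {IH rq} => [|b q] //= h ba; apply: h; rewrite ba.
Qed.

Lemma fiber_reduced (v : vert F) p : gpath v p v -> reduced p -> p = [::].
Proof.
move=> hp rp; have vf : sub_vert (fiber A (mom A v)) v by [].
have [q hq qp] := @fiber_path _ (exist _ v vf) (exist _ v vf) _ hp.
have : q = [::] by apply: (treeF _).2 hq _; apply: reduced_sval; rewrite qp.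
by move=> q0; rewrite -qp q0.
Qed.

Lemma fiber_linked v w : mom A v = mom A w -> linked v w.
Proof.
move=> vw; have vf : sub_vert (fiber A (mom A w)) v by [].
have wf : sub_vert (fiber A (mom A w)) w by [].
have [q hq] := (treeF (mom A w)).1 (exist _ v vf) (exist _ w wf).
exists (map (@sval _ _) q).
have h (p : seq (edge (fiber A (mom A w)))) y z : gpath y p z ->
    gpath (sval y) (map (@sval _ _) p) (sval z).
  by elim: p y => [|e p IH] y /= => [->//|[<- /IH]].
exact: h hq.
Qed.

(** Otherwise the two parallel edges would form a reduced closed path of length 2. *)
Lemma fiber_edge_inj (e e' : edge F) :
  org e = org e' -> trm e = trm e' -> e = e'.
Proof.
move=> oo tt; apply: contrapT => ee'.
suff: [:: bar e; e'] = [::] by [].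
apply: (@fiber_reduced (org e)) => /=; first by rewrite trm_bar org_bar.
by split=> //; rewrite barK => /esym.
Qed.

(** The axioms of an action only mention origins and targets; compatibility with
    edge reversal holds because edges of a tree are determined by their
    endpoints. *)
Lemma actE_bar g e : gsrc g = momE A e -> actE A g (bar e) = bar (actE A g e).
Proof.
move=> ge; have ge' : gsrc g = mom A (trm (bar e)) by rewrite ge -momE_bar.
apply: fiber_edge_inj.
  by rewrite org_actE // !org_bar trm_actE.
by rewrite trm_actE // !trm_bar org_actE.
Qed.

End ActionFacts.

(** * Desingularizations under the wideness assumption *)

Section Desingularization.
Variables (G : groupoid) (F : graph) (A : action G F).
Variables (D : desingularization A) (wD : wide (d_gog D)).

Local Notation GG := (d_gog D).
Local Notation T := (d_tree D).
Local Notation r := (d_root D).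
Local Notation Gam := (d_graph D).
Local Notation sigV := (d_sigV D).
Local Notation sigE := (d_sigE D).
Local Notation Te := (sub_edge T).
Local Notation Up := (d_upos D).
Local Notation Un := (bar_set (d_upos D)).
Local Notation Pi := (pi1 wD).
Implicit Types (v : vert Gam) (e : edge Gam) (x y : gobj G).

(** The three families T^1, Upsilon_+ and Upsilon_- of edges, on which g_(e,x)
    and alpha_e are defined by different formulas. *)
Variant edge_kind e : Prop :=
  | TreeEdge of Te e & Te (bar e)
  | PosEdge of ~ Te e & d_pos D e & Up e & Un (bar e)
  | NegEdge of ~ Te e & ~ d_pos D e & Un e & Up (bar e).

Lemma upos_not_tree e : Up e -> ~ Te e.
Proof.
by move=> ue te; have : (Up `&` Te) e by []; rewrite d_upos_tree.
Qed.

Lemma tree_bar e : Te (bar e) -> Te e.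
Proof. by move=> /(@sub_bar _ T); rewrite barK. Qed.

Lemma edge_kindP e : edge_kind e.
Proof.
have [[pe _]|[npe pe]] := (d_pos_orient D).2 e I; have := pe;
  rewrite d_posU => -[te|ue].
- have {}te : Te e by apply: (d_treepos_orient D).1.
  by apply: TreeEdge => //; apply: sub_bar.
- by apply: PosEdge => //; [apply: upos_not_tree | exists e].
- have {}te : Te (bar e) by apply: (d_treepos_orient D).1.
  by apply: TreeEdge => //; apply: tree_bar.
- apply: NegEdge => //; last by exists (bar e) => //; rewrite barK.
  by move=> /(@sub_bar _ T) /=; apply: upos_not_tree.
Qed.

Lemma uneg_not_upos e : Un e -> ~ Up e.
Proof.
have P f : Up f -> d_pos D f by rewrite d_posU; right.
move=> [f uf <-] ue; have [[_ n]|[n _]] := (d_pos_orient D).2 f I.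
  exact/n/P.
exact/n/P.
Qed.

Lemma pos_incl e : d_pos D e -> (Te `|` Up) e.
Proof.
by rewrite d_posU => -[/(d_treepos_orient D).1 te|ue]; [left | right].
Qed.

Lemma units_vertE v : units (gg_vert GG v) = d_XV D v.
Proof.
apply/seteqP; split=> x; rewrite /units /= d_gog_vert /stabV /= gsrc_id grng_id.
  by case.
move=> vx; split=> //.
by rewrite -{1}(d_sigV_section vx) actV_id.
Qed.

Lemma units_edgeE e : units (gg_edge GG e) = d_XE D e.
Proof.
apply/seteqP; split=> x; rewrite /units /= d_gog_edge /stabE /= gsrc_id grng_id.
  by case.
move=> ex; split=> //.
by rewrite -{1}(d_sigE_section ex) actE_id.
Qed.

Lemma alpha0_incl e x : (Te `|` Up) e -> d_XE D e x -> alpha0 GG e x = x.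
Proof.
move=> te ex; rewrite /alpha0 d_gog_incl ?grng_id //.
by move: ex; rewrite -units_edgeE.
Qed.

(** When alpha_e is an inclusion it can only be wide if the two unit spaces agree. *)
Lemma XE_eq_XV e : (Te `|` Up) e -> d_XE D e = d_XV D (trm e).
Proof.
move=> te; apply/seteqP; split=> x.
  move=> ex; rewrite -[x](alpha0_incl te ex) -units_vertE.
  by apply: alpha0_unit; rewrite units_edgeE.
rewrite -units_vertE => /(wide_unit wD)[z]; rewrite units_edgeE => ez ->.
by rewrite alpha0_incl.
Qed.

(** X_r is the whole unit space, and for a tree edge both alpha_e and
    alpha_(bar e) are inclusions, so that X_v does not change along T. *)
Lemma XV_full v x : d_XV D v x.
Proof.
have [p] := (mtree_tree T).1 (tvtx T v) (tvtx T r).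
have : sval (tvtx T v) = v by [].
elim: p v (tvtx T v) => [|e p IH] v w <- /=.
  by move=> ->; rewrite /= d_XV_root.
move=> [<- hp] /=; have te := svalP e.
rewrite -XE_eq_XV; last by left.
rewrite -d_XE_bar XE_eq_XV ?trm_bar; last by left; apply: sub_bar.
exact: IH hp.
Qed.

Lemma XE_full e x : d_XE D e x.
Proof.
have [te _|_ _ ue _|_ _ _ ue] := edge_kindP e.
- by rewrite XE_eq_XV; [apply: XV_full | left].
- by rewrite XE_eq_XV; [apply: XV_full | right].
- by rewrite -d_XE_bar XE_eq_XV; [apply: XV_full | right].
Qed.

Lemma vert_unit v x : units (gg_vert GG v) x.
Proof. by rewrite units_vertE; apply: XV_full. Qed.

Lemma edge_unit e x : units (gg_edge GG e) x.
Proof. by rewrite units_edgeE; apply: XE_full. Qed.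

Lemma mom_sigV v x : mom A (sigV v x) = x.
Proof. exact/d_sigV_section/XV_full. Qed.

Lemma mom_sigE e x : momE A (sigE e x) = x.
Proof. exact/d_sigE_section/XE_full. Qed.

Lemma alpha_incl e k : (Te `|` Up) e -> gg_edge GG e k -> gg_alpha GG e k = k.
Proof. exact: d_gog_incl. Qed.

Lemma alpha0_id e x : (Te `|` Up) e -> alpha0 GG e x = x.
Proof. by move=> te; apply: alpha0_incl => //; apply: XE_full. Qed.

Lemma gsrc_d_g e x : Un e -> gsrc (d_g D e x) = x.
Proof. by move=> ue; have [] := d_uneg_ends ue (XE_full e x). Qed.

Lemma alpha0_uneg e x : Un e -> alpha0 GG e x = grng (d_g D e x).
Proof.
move=> ue; rewrite /alpha0 d_gog_conj //; last exact: edge_unit.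
rewrite gsrc_id grng_id.
have c : gsrc (d_g D e x) = grng (gid x) by rewrite gsrc_d_g // grng_id.
by rewrite !grng_mul ?gsrc_mul // gsrc_id grng_inv gsrc_d_g.
Qed.

Lemma phi0_alpha e x : phi0 GG e (alpha0 GG (bar e) x) = alpha0 GG e x.
Proof. exact/phi0_alpha0/edge_unit. Qed.

Lemma phi0K e x : phi0 GG (bar e) (phi0 GG e x) = x.
Proof. exact/(phi0_barK wD)/vert_unit. Qed.

Lemma phi0_barE e x : phi0 GG e (phi0 GG (bar e) x) = x.
Proof. by rewrite -{1}[e]barK phi0K. Qed.

Lemma phi0_tree e x : Te e -> phi0 GG e x = x.
Proof.
move=> te; have bte : Te (bar e) by apply: sub_bar.
by rewrite -{1}[x](@alpha0_id (bar e)) ?phi0_alpha ?alpha0_id //; left.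
Qed.

Lemma phi0_uneg e x : Un e -> Up (bar e) -> phi0 GG e x = grng (d_g D e x).
Proof.
move=> ue ube; rewrite -alpha0_uneg // -{1}[x](@alpha0_id (bar e)); last by right.
exact: phi0_alpha.
Qed.

(** The bijections phi_e of the tree edges are identities. *)
Lemma tau_id v x : tau GG T r v x = x.
Proof.
have h a b : tree_equiv GG T a b -> a.2 = b.2.
  elim=> {a b} //=.
    by move=> a b [e [z [te _ -> ->]]] /=; rewrite phi0_tree.
  by move=> a b c _ -> _ ->.
exact/esym/(h _ _ (tau_equiv wD T r (vert_unit v x))).
Qed.

Lemma g_ext_tree e x : Te e -> g_ext e x = gid x.
Proof. by move=> te; rewrite /g_ext asboolT. Qed.

Lemma g_ext_uneg e x : ~ Te e -> Un e -> g_ext e x = d_g D e x.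
Proof. by move=> te ue; rewrite /g_ext asboolF // asboolT. Qed.

(** The choice in the definition of g_(e,y) for e in Upsilon_+ is unambiguous,
    because x |-> r(g_(bar e,x)) is the restriction of alpha_(bar e) to units and
    alpha_(bar e) is injective. *)
Lemma g_ext_upos e x : ~ Te e -> Up e -> Un (bar e) ->
  g_ext e (grng (d_g D (bar e) x)) = ginv (d_g D (bar e) x).
Proof.
move=> te ue ube; rewrite /g_ext asboolF // asboolF; last by move=> /uneg_not_upos.
congr (ginv (d_g D _ _)).
apply: choose_in_uniq; first by split=> //; apply: XE_full.
move=> y [_ yx]; move: yx; rewrite -!alpha0_uneg // => /(congr1 (phi0 GG e)).
by rewrite !phi0_alpha !alpha0_id //; right.
Qed.

(** The map x |-> r(g_(bar e,x)) is onto, by wideness. *)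
Lemma upos_rng e x : Up e -> Un (bar e) ->
  exists2 y, x = grng (d_g D (bar e) y) & y = phi0 GG e x.
Proof.
move=> ue ube; exists (phi0 GG e x) => //.
rewrite -alpha0_uneg // -phi0_alpha barK.
by rewrite (@alpha0_id e) ?phi0K //; right.
Qed.

Lemma g_ext_ends e x :
  grng (g_ext e x) = phi0 GG e x /\ gsrc (g_ext e x) = x.
Proof.
have [te _|te _ ue ube|te _ ue ube] := edge_kindP e.
- by rewrite g_ext_tree // grng_id gsrc_id phi0_tree.
- have [y -> _] := upos_rng x ue ube.
  rewrite g_ext_upos // grng_inv gsrc_inv gsrc_d_g // -alpha0_uneg //.
  by rewrite phi0_alpha alpha0_id //; right.
- by rewrite g_ext_uneg // gsrc_d_g // phi0_uneg.
Qed.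

Lemma grng_g_ext e x : grng (g_ext e x) = phi0 GG e x.
Proof. by have [] := g_ext_ends e x. Qed.

Lemma gsrc_g_ext e x : gsrc (g_ext e x) = x.
Proof. by have [] := g_ext_ends e x. Qed.

Lemma g_extV e x : ginv (g_ext e x) = g_ext (bar e) (phi0 GG e x).
Proof.
have [te bte|te _ ue ube|te _ ue ube] := edge_kindP e.
- by rewrite !g_ext_tree // ginv_id phi0_tree.
- have [y -> yE] := upos_rng x ue ube.
  rewrite g_ext_upos // ginvK -alpha0_uneg // phi0_alpha alpha0_id; last by right.
  by rewrite g_ext_uneg // => /tree_bar.
- have := @g_ext_upos (bar e) x; rewrite barK => h.
  by rewrite g_ext_uneg // phi0_uneg // h // => /tree_bar.
Qed.

(** The relation (R2) evaluated in G, with the last symbol moved to the other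
    side. *)
Lemma g_ext_comm e k : gg_edge GG e k ->
  gmul (g_ext e (alpha0 GG (bar e) (grng k))) (gg_alpha GG (bar e) k) =
  gmul (gg_alpha GG e k) (g_ext e (alpha0 GG (bar e) (gsrc k))).
Proof.
move=> ek; have bek : gg_edge GG (bar e) k by rewrite gg_edge_bar.
have [te bte|te _ ue ube|te _ ue ube] := edge_kindP e.
- have [l bl] : (Te `|` Up) e /\ (Te `|` Up) (bar e) by split; left.
  rewrite (alpha_incl l ek) (alpha_incl bl bek) !(alpha0_id _ bl).
  by rewrite !g_ext_tree // gmul1g gmulg1.
- rewrite (alpha0_uneg (grng k)) // (alpha0_uneg (gsrc k)) // !g_ext_upos //.
  rewrite (alpha_incl _ ek) ?d_gog_conj //; last by right.
  rewrite -gmulA ?grng_inv ?gsrc_mul ?gsrc_d_g //.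
  rewrite gmulKg // grng_mul ?grng_mul ?gsrc_mul ?grng_inv ?gsrc_d_g //.
- have bl : (Te `|` Up) (bar e) by right.
  rewrite !(alpha0_id _ bl) (alpha_incl bl bek) d_gog_conj //.
  rewrite !g_ext_uneg // gmulgVK // gsrc_mul ?gsrc_d_g //.
Qed.

(** For e in Upsilon_+ the origin of sigma_e is the target of sigma_(bar e),
    which is known only up to the translation by g_(bar e,x) = g_(e,y)^-1. *)
Lemma org_sigE e x :
  org (sigE e x) = if `[< d_pos D e >]
    then actV A (g_ext e (phi0 GG (bar e) x)) (sigV (org e) (phi0 GG (bar e) x))
    else sigV (org e) x.
Proof.
have ex := XE_full e x.
have [te bte|te pe ue ube|te pe ue ube] := edge_kindP e.
- have [-> _] := d_tree_ends te ex; case: asboolP => // _.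
  by rewrite phi0_tree // g_ext_tree // -[in gid _](mom_sigV (org e) x) actV_id.
- rewrite asboolT // phi0_uneg ?barK //.
  rewrite g_ext_upos // -trm_bar -d_sigE_bar //.
  have [_ _ se [z _ zE]] := d_uneg_ends ube (XE_full (bar e) x).
  set s := trm (sigE _ _) in zE *.
  have ms : gsrc (d_g D (bar e) x) = mom A s by rewrite se /s -/(momE A _) mom_sigE.
  (* The element g_(bar e,x) s is some sigma_(o(e))(z); comparing momenta
     identifies z with r(g_(bar e,x)). *)
  have -> : s = actV A (ginv (d_g D (bar e) x)) (actV A (d_g D (bar e) x) s).
    by rewrite actVK.
  congr actV; rewrite -zE -[in LHS](mom_sigV (trm (bar e)) z) zE mom_actV //.
  by rewrite trm_bar.
- rewrite asboolF //; by have [_ ->] := d_uneg_ends ue ex.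
Qed.

(** * The homomorphism from the fundamental groupoid *)

Definition psi_gen (a : gen Gam G) : garr G :=
  match a with inl (_, g) => g | inr (e, x) => g_ext e x end.

Lemma psi_gen_ends (a : pr_sym (pi1_presentation wD T r)) : pr_gen a ->
  grng (psi_gen a) = pr_rng a /\ gsrc (psi_gen a) = pr_src a.
Proof.
by case: a => [[v g]|[e x]] _ /=; rewrite !tau_id ?grng_g_ext ?gsrc_g_ext.
Qed.

Lemma psi_gen_rel (t u : word _ (pr_sym (pi1_presentation wD T r))) :
  pr_rel t u -> weval (P := pi1_presentation wD T r) id psi_gen t =
                weval (P := pi1_presentation wD T r) id psi_gen u.
Proof.
case=> //= {t u}.
- by move=> v y _; rewrite tau_id.
- by move=> e x _; rewrite g_extV.
- by move=> e x te _; rewrite tau_id g_ext_tree.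
- move=> e k ek; have bek : gg_edge GG (bar e) k by rewrite gg_edge_bar.
  rewrite g_ext_comm // -[alpha0 GG e _]phi0_alpha -g_extV gmulgK //.
  by rewrite grng_g_ext phi0_alpha gsrc_alpha.
Qed.

Definition psi : groupoid_hom Pi G := pres_hom psi_gen_ends psi_gen_rel.

Definition vert_arr v g (vg : gg_vert GG v g) : garr Pi := pi1_vert wD T r vg.
Definition edge_arr e x : garr Pi := pi1_edge wD T r (vert_unit (org e) x).

Lemma psi_vert_arr v g (vg : gg_vert GG v g) : psi (vert_arr vg) = g.
Proof. exact: (pres_arrE psi_gen_ends psi_gen_rel). Qed.

Lemma psi_edge_arr e x : psi (edge_arr e x) = g_ext e x.
Proof. exact: (pres_arrE psi_gen_ends psi_gen_rel). Qed.

Lemma psi_obj (x : gobj Pi) : hom_obj psi x = sval x.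
Proof. by []. Qed.

Lemma is_psi_psi : is_psi psi.
Proof.
split=> [v g vg|e x ex]; first exact: psi_vert_arr.
by rewrite -psi_edge_arr /edge_arr; congr (psi _); apply: pi1_edge_irr.
Qed.

(** Since psi is injective on units, composability can be tested after applying
    it. *)
Lemma pi1_comp (p q : garr Pi) : gsrc (psi p) = grng (psi q) -> gsrc p = grng q.
Proof. by rewrite hom_src hom_rng; apply: sval_inj. Qed.

Lemma pi1_rng_eq (p q : garr Pi) : grng (psi p) = grng (psi q) -> grng p = grng q.
Proof. by rewrite !hom_rng; apply: sval_inj. Qed.

Lemma pi1_ind (Q : garr Pi -> Prop) :
  (forall x : gobj Pi, Q (gid x)) ->
  (forall v g (vg : gg_vert GG v g), Q (vert_arr vg)) ->
  (forall e x, Q (edge_arr e x)) ->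
  (forall p, Q p -> Q (ginv p)) ->
  (forall p q, gsrc p = grng q -> Q p -> Q q -> Q (gmul p q)) ->
  forall p, Q p.
Proof.
move=> Q1 Qv Qe QV QM; apply: presented_ind => //.
case=> [[v g]|[e x]] wa; first exact: Qv wa.
suff -> : pr_cls wa = edge_arr e x by [].
exact: (pi1_edge_irr wD T r wa).
Qed.

(** The homomorphisms agree on generators; a unit x of the fundamental groupoid
    is the generator id_x of the root groupoid. *)
Lemma psi_unique (f : groupoid_hom Pi G) : is_psi f -> psi = f.
Proof.
move=> [fv fe]; apply: groupoid_hom_eq => p; elim/pi1_ind: p.
- move=> x; rewrite !hom_id psi_obj.
  have h : pi1_vert wD T r (vert_unit r (sval x)) = gid x.
    have := pi1_vert1 (vert_unit r (sval x)) (p := gid x : garr Pi).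
    rewrite gsrc_id tau_id => /(_ erefl) <-.
    rewrite -[LHS](gmul1g _); congr (gmul (gid _) _).
    by apply: sval_inj; rewrite grng_pi1_vert tau_id grng_id.
  by rewrite -hom_id -h fv.
- by move=> v g vg; rewrite psi_vert_arr fv.
- by move=> e x; rewrite psi_edge_arr fe.
- move=> p pf; have inv (f' : groupoid_hom Pi G) : f' (ginv p) = ginv (f' p).
    rewrite -[LHS](gmulgK (h := f' p)); last by rewrite hom_src hom_rng gsrc_inv.
    rewrite -hom_mul ?gsrc_inv // gmulVg hom_id -hom_src -grng_inv gmul1g //.
  by rewrite !inv pf.
- by move=> p q pq pf qf; rewrite !hom_mul // pf qf.
Qed.

(** * Cosets in the fundamental groupoid *)

Lemma vert_arr_eq v w g h (vg : gg_vert GG v g) (wh : gg_vert GG w h) :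
  v = w -> g = h -> vert_arr vg = vert_arr wh.
Proof. by move=> vw gh; subst w h; apply: pi1_vert_irr. Qed.

Lemma vert_arrM v g h (vg : gg_vert GG v g) (vh : gg_vert GG v h)
    (vgh : gg_vert GG v (gmul g h)) : gsrc g = grng h ->
  gmul (vert_arr vg) (vert_arr vh) = vert_arr vgh.
Proof. exact: pi1_vertM. Qed.

Lemma vert_arr1 v x (vx : gg_vert GG v (gid x)) (p : garr Pi) :
  gsrc (psi p) = x -> gmul p (vert_arr vx) = p.
Proof. by rewrite hom_src => px; apply: pi1_vert1; rewrite tau_id. Qed.

Lemma psi_mul_vert_arr v g (vg : gg_vert GG v g) (p : garr Pi) :
  gsrc (psi p) = grng g -> psi (gmul p (vert_arr vg)) = gmul (psi p) g.
Proof.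
by move=> pg; rewrite hom_mul ?psi_vert_arr //; apply: pi1_comp; rewrite psi_vert_arr.
Qed.

Lemma cosetP (p : garr Pi) v K q : coset p v K q <->
  exists k (vk : gg_vert GG v k),
    [/\ K k, gsrc (psi p) = grng k & q = gmul p (vert_arr vk)].
Proof.
by split=> -[k [vk [Kk pk qE]]]; exists k, vk; split=> //; move: pk;
  rewrite hom_src tau_id.
Qed.

Lemma coset_eqP (p q : garr Pi) v K : subgroupoid K -> (forall x, K (gid x)) ->
  coset p v K = coset q v K <-> coset p v K q.
Proof.
move=> sK K1.
have refl (p' : garr Pi) : coset p' v K p'.
  apply/cosetP; exists (gid (gsrc (psi p'))), (vert_unit v _).
  by rewrite grng_id; split=> //; rewrite vert_arr1.
have trans (p' q' u : garr Pi) :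
    coset p' v K q' -> coset q' v K u -> coset p' v K u.
  move=> /cosetP[k [vk [Kk pk ->]]] /cosetP[h [vh [Kh kh ->]]].
  have c : gsrc (psi p') = grng (psi (vert_arr vk)) by rewrite psi_vert_arr.
  move: kh; rewrite psi_mul_vert_arr // gsrc_mul // => kh.
  have vkh := (gg_vert_sub GG v).2 _ _ vk vh kh.
  apply/cosetP; exists (gmul k h), vkh; split; [exact: sK.2|by rewrite grng_mul|].
  by rewrite -gmulA ?(vert_arrM _ _ vkh) //; apply: pi1_comp; rewrite !psi_vert_arr.
have sym (p' q' : garr Pi) : coset p' v K q' -> coset q' v K p'.
  move=> /cosetP[k [vk [Kk pk ->]]]; have vk' := (gg_vert_sub GG v).1 _ vk.
  have kk : gsrc k = grng (ginv k) by rewrite grng_inv.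
  apply/cosetP; exists (ginv k), vk'; split; first exact: sK.1.
    by rewrite psi_mul_vert_arr // gsrc_mul // grng_inv.
  have vkk := (gg_vert_sub GG v).2 _ _ vk vk' kk.
  rewrite -gmulA ?(vert_arrM _ _ vkk) //;
    try by apply: pi1_comp; rewrite !psi_vert_arr.
  by rewrite (vert_arr_eq vkk (vert_unit v (grng k)) erefl (gmulgV k)) vert_arr1.
split=> [->//|pq]; apply/seteqP; split=> u; last exact: trans.
exact/trans/sym.
Qed.

Lemma vcoset_eqP (p q : garr Pi) v : vcoset p v = vcoset q v <-> vcoset p v q.
Proof. apply: coset_eqP; [exact: gg_vert_sub | exact: vert_unit]. Qed.

(** The edge |e| belongs to the orientation, where alpha is an inclusion. *)
Lemma H_abs e : gg_H GG (abs_edge (d_pos D) e) = gg_edge GG e.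
Proof.
have -> : gg_edge GG e = gg_edge GG (abs_edge (d_pos D) e).
  by rewrite /abs_edge; case: ifP => // _; rewrite gg_edge_bar.
have pe : d_pos D (abs_edge (d_pos D) e).
  rewrite /abs_edge; case: asboolP => // ne.
  by have [[]|[]] := (d_pos_orient D).2 e I.
apply/seteqP; split=> k.
  by move=> [g eg <-]; rewrite alpha_incl //; apply: pos_incl.
by move=> ek; exists k => //; apply: alpha_incl => //; apply: pos_incl.
Qed.

Lemma ecosetE (p : garr Pi) e : ecoset (d_pos D) p e =
  coset p (trm (abs_edge (d_pos D) e)) (gg_edge GG e).
Proof. by rewrite /ecoset H_abs. Qed.

Lemma ecoset_eqP (p q : garr Pi) e :
  ecoset (d_pos D) p e = ecoset (d_pos D) q e <-> ecoset (d_pos D) p e q.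
Proof.
rewrite !ecosetE; apply: coset_eqP; [exact: gg_edge_sub | exact: edge_unit].
Qed.

Lemma pi1_mul_edge_arr (p : garr Pi) e :
  pi1_mul_edge p e = gmul p (edge_arr e (phi0 GG (bar e) (gsrc (psi p)))).
Proof. by rewrite hom_src; apply: pi1_mul_edgeE; rewrite tau_id phi0_barE. Qed.

Lemma psi_mul_edge_arr (p : garr Pi) e : psi (pi1_mul_edge p e) =
  gmul (psi p) (g_ext e (phi0 GG (bar e) (gsrc (psi p)))).
Proof.
rewrite pi1_mul_edge_arr hom_mul ?psi_edge_arr //; apply: pi1_comp.
by rewrite psi_edge_arr grng_g_ext phi0_barE.
Qed.

(** * The graph homomorphism from the Bass-Serre forest *)

Lemma translate_sigV_coset (p q : garr Pi) v : vcoset p v q ->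
  actV A (psi q) (sigV v (gsrc (psi q))) = actV A (psi p) (sigV v (gsrc (psi p))).
Proof.
move=> /cosetP[k [vk [_ pk ->]]]; rewrite psi_mul_vert_arr // gsrc_mul //.
move: vk; rewrite d_gog_vert => -[_ _ kE].
by rewrite actVM ?mom_sigV // kE pk.
Qed.

Lemma translate_sigE_coset (p q : garr Pi) e : ecoset (d_pos D) p e q ->
  actE A (psi q) (sigE e (gsrc (psi q))) = actE A (psi p) (sigE e (gsrc (psi p))).
Proof.
rewrite ecosetE => /cosetP[k [vk [ek pk ->]]].
rewrite psi_mul_vert_arr // gsrc_mul //.
move: ek; rewrite d_gog_edge => -[_ _ kE].
by rewrite actEM ?mom_sigE // kE pk.
Qed.

Definition Psi0 (a : vert (bsf wD)) : vert F :=
  let p := sval (cid (svalP a)) in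
  actV A (psi p) (sigV (sval a).1 (gsrc (psi p))).

Definition Psi1 (a : edge (bsf wD)) : edge F :=
  actE A (psi (bs_rep a)) (sigE (bs_tag a) (gsrc (psi (bs_rep a)))).

Definition coset_vert (p : garr Pi) v : vert (bsf wD) := bs_vert_of p v.
Definition coset_edge (p : garr Pi) e : edge (bsf wD) := bs_edge_of (d_pos D) p e.

Lemma coset_vertP (a : vert (bsf wD)) : exists p v, a = coset_vert p v.
Proof.
case: a => [[v K] [p pK]]; exists p, v; apply: sval_inj => /=.
by rewrite -pK.
Qed.

Lemma coset_edgeP (a : edge (bsf wD)) : exists p e, a = coset_edge p e.
Proof. by exists (bs_rep a), (bs_tag a); apply: bs_repP. Qed.

Lemma Psi0E p v : Psi0 (coset_vert p v) = actV A (psi p) (sigV v (gsrc (psi p))).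
Proof.
rewrite /Psi0; case: cid => q /= pq; apply: translate_sigV_coset.
exact/vcoset_eqP.
Qed.

Lemma Psi1E p e : Psi1 (coset_edge p e) = actE A (psi p) (sigE e (gsrc (psi p))).
Proof. exact/translate_sigE_coset/bs_rep_coset. Qed.

Lemma coset_vert_eq (p q : garr Pi) v :
  vcoset p v q -> coset_vert p v = coset_vert q v.
Proof. by move=> /vcoset_eqP h; apply: sval_inj; rewrite /= h. Qed.

Lemma coset_edge_eq (p q : garr Pi) e :
  ecoset (d_pos D) p e q -> coset_edge p e = coset_edge q e.
Proof. by move=> /ecoset_eqP h; apply: sval_inj; rewrite /= h. Qed.

Lemma org_coset_edge p e :
  org (coset_edge p e) =
  coset_vert (if `[< d_pos D e >] then pi1_mul_edge p e else p) (org e).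
Proof. exact: org_bs_edge. Qed.

Lemma bar_coset_edge p e : bar (coset_edge p e) = coset_edge p (bar e).
Proof. exact: bs_bar_of. Qed.

Hypothesis treeF : forall x : gobj G, is_tree (fiber A x).

Lemma Psi_org a : org (Psi1 a) = Psi0 (org a).
Proof.
have [p [e ->]] := coset_edgeP a; rewrite org_coset_edge Psi0E Psi1E.
rewrite org_actE; last by rewrite -/(momE A _) mom_sigE.
rewrite org_sigE; case: asboolP => // pe.
set y := phi0 GG (bar e) _.
have c : gsrc (psi p) = grng (g_ext e y) by rewrite grng_g_ext phi0_barE.
by rewrite psi_mul_edge_arr -/y gsrc_mul // gsrc_g_ext actVM // mom_sigV gsrc_g_ext.
Qed.

Lemma Psi_bar a : bar (Psi1 a) = Psi1 (bar a).
Proof.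
have [p [e ->]] := coset_edgeP a; rewrite bar_coset_edge !Psi1E.
by rewrite d_sigE_bar ?actE_bar ?mom_sigE //; apply: XE_full.
Qed.

Lemma Psi_trm a : trm (Psi1 a) = Psi0 (trm a).
Proof. by rewrite -[a]barK -Psi_bar !trm_bar Psi_org. Qed.

Definition Psi : graph_hom (bsf wD) F := GraphHom Psi_org Psi_trm Psi_bar.

Lemma is_Psi_Psi : is_Psi psi Psi.
Proof.
by split=> [p v|p e]; [rewrite [LHS]Psi0E hom_src | rewrite [LHS]Psi1E hom_src].
Qed.

Lemma Psi_unique (f : graph_hom (bsf wD) F) : is_Psi psi f -> Psi = f.
Proof.
move=> [fv fe]; have [Pv Pe] := is_Psi_Psi; apply: graph_hom_eq => a.
  by have [p [v ->]] := coset_vertP a; rewrite [LHS]Pv fv.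
by have [p [e ->]] := coset_edgeP a; rewrite [LHS]Pe fe.
Qed.

Lemma edge_cover f : exists h e, f = actE A h (sigE e (gsrc h)).
Proof.
have : (\bigcup_e satE A (sigE e @` d_XE D e)) f by rewrite d_satE_cover.
by move=> [e _ [g [_ [[x _ <-] gx ->]]]]; exists g, e; rewrite gx mom_sigE.
Qed.

Lemma satV_self g v : satV A (sigV v @` d_XV D v) (actV A g (sigV v (gsrc g))).
Proof.
exists g, (sigV v (gsrc g)); rewrite mom_sigV; split=> //.
by exists (gsrc g) => //; apply: XV_full.
Qed.

Lemma satE_self g e : satE A (sigE e @` d_XE D e) (actE A g (sigE e (gsrc g))).
Proof.
exists g, (sigE e (gsrc g)); rewrite mom_sigE; split=> //.
by exists (gsrc g) => //; apply: XE_full.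
Qed.

(** Translates of sigma_v and sigma_w cannot meet for v <> w, and the stabilizer
    of sigma_v is exactly G_v.  This is what relates equality of images under
    Psi to equality of cosets. *)
Lemma translate_sigV_eq g h v w :
  actV A g (sigV v (gsrc g)) = actV A h (sigV w (gsrc h)) ->
  [/\ v = w, grng g = grng h & gg_vert GG v (gmul (ginv g) h)].
Proof.
move=> gh; have vw : v = w.
  apply: (d_satV_disj (d := D)) => //; exists (actV A g (sigV v (gsrc g))).
  by split; [|rewrite gh]; apply: satV_self.
have rr : grng g = grng h.
  by have := congr1 (mom A) gh; rewrite !mom_actV ?mom_sigV.
split=> //; rewrite d_gog_vert; apply: stabV_quot; rewrite ?gh ?vw //;
  [exact: d_sigV_section | exact: XV_full | exact: XV_full].
Qed.

Lemma translate_sigE_eq g h e f :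
  actE A g (sigE e (gsrc g)) = actE A h (sigE f (gsrc h)) ->
  [/\ e = f, grng g = grng h & gg_edge GG e (gmul (ginv g) h)].
Proof.
move=> gh; have ef : e = f.
  apply: (d_satE_disj (d := D)) => //; exists (actE A g (sigE e (gsrc g))).
  by split; [|rewrite gh]; apply: satE_self.
have rr : grng g = grng h.
  by have := congr1 (momE A) gh; rewrite /momE !mom_actE -/(momE A _) ?mom_sigE.
split=> //; rewrite d_gog_edge; apply: stabE_quot; rewrite ?gh ?ef //;
  [exact: d_sigE_section | exact: XE_full | exact: XE_full].
Qed.

Lemma gg_edge_sub_vert e k : gg_edge GG e k ->
  gg_vert GG (trm (abs_edge (d_pos D) e)) k.
Proof.
rewrite -H_abs => -[g eg <-]; exact: gg_alpha_in.
Qed.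

(** Let p H_|e| [e] and q H_|e| [e] have the same image, so that
    psi(q) = psi(p) k with k in G_e.  This equation has to be lifted to q = p k
    in the fundamental groupoid.  The common origin gives it directly when e is
    not in the orientation.  Otherwise it gives q e = p e m with m in
    G_(o(e)); applying psi identifies m with alpha_(bar e)(k), and relation (R2)
    turns e m into k e. *)
Lemma Psi_star_inj a b : org a = org b -> Psi1 a = Psi1 b -> a = b.
Proof.
have [p [e ->]] := coset_edgeP a; have [q [f ->]] := coset_edgeP b.
rewrite !Psi1E => oo /translate_sigE_eq[ef pq ek]; subst f.
set k := gmul _ _ in ek; have vk := gg_edge_sub_vert ek.
have pk : gsrc (psi p) = grng k by rewrite /k grng_mul ?grng_inv ?gsrc_inv.
have qk : psi q = gmul (psi p) k by rewrite gmulVKg.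
clearbody k.
have sk : gsrc (psi q) = gsrc k by rewrite qk gsrc_mul.
apply: coset_edge_eq; rewrite ecosetE; apply/cosetP; exists k, vk; split=> //.
move: oo; rewrite !org_coset_edge => /(congr1 (fun a => (sval a).2)) /= /vcoset_eqP.
move=> /cosetP[m [vm [_]]].
case: asboolP => pe; last first.
  move=> pm qE; rewrite qE; congr (gmul p _).
  have mk : m = k.
    by move: qk; rewrite qE psi_mul_vert_arr // => /gmulgI; apply.
  have absE : abs_edge (d_pos D) e = bar e by rewrite /abs_edge asboolF.
  by apply: vert_arr_eq => //; rewrite absE trm_bar.
have absE : abs_edge (d_pos D) e = e by rewrite /abs_edge asboolT.
have bek : gg_edge GG (bar e) k by rewrite gg_edge_bar.
have incl := pos_incl pe.
have al x : phi0 GG (bar e) x = alpha0 GG (bar e) x.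
  have := phi0_alpha (bar e) x; rewrite barK alpha0_id //.
have kE := alpha_incl incl ek.
have c1 : gsrc (psi p) = grng (g_ext e (alpha0 GG (bar e) (grng k))).
  by rewrite grng_g_ext -al phi0_barE.
have c2 : gsrc k = grng (g_ext e (alpha0 GG (bar e) (gsrc k))).
  by rewrite grng_g_ext -al phi0_barE.
have c3 : gsrc (g_ext e (alpha0 GG (bar e) (grng k))) =
          grng (gg_alpha GG (bar e) k).
  by rewrite gsrc_g_ext grng_alpha.
(* From here on e is in the orientation; psi determines m. *)
rewrite psi_mul_edge_arr pk al gsrc_mul // => pm qE.
have := congr1 (hom_arr psi) qE.
rewrite psi_mul_vert_arr; last by rewrite psi_mul_edge_arr pk al gsrc_mul.
rewrite !psi_mul_edge_arr pk sk !al qk -!gmulA //.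
have := g_ext_comm ek; rewrite kE => <-.
move=> /gmulgI; rewrite !grng_mul // => /(_ c1 c1) /gmulgI => /(_ c3 pm) mE.
subst m.
have vk' : gg_vert GG (trm e) (gg_alpha GG e k) by rewrite kE -absE.
(* The relation (R2): k (phi_e(y'), y') = (phi_e(y), y) m. *)
have := pi1_edge_comm wD T r ek (vert_unit _ _) (vert_unit _ _) vm vk'.
rewrite -/(edge_arr _ _) -/(edge_arr _ _) -/(vert_arr _) -/(vert_arr _) => comm.
move: qE; rewrite !pi1_mul_edge_arr pk sk !al -[in RHS]gmulA; last first.
- by apply: pi1_comp; rewrite psi_edge_arr psi_vert_arr.
- by apply: pi1_comp; rewrite psi_edge_arr.
rewrite comm.
have arrk : vert_arr vk' = vert_arr vk by apply: vert_arr_eq; rewrite ?absE.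
rewrite arrk gmulA; last first.
- by apply: pi1_comp; rewrite psi_vert_arr psi_edge_arr.
- by apply: pi1_comp; rewrite psi_vert_arr.
apply: gmulIg; apply: pi1_comp;
  by rewrite psi_edge_arr ?psi_mul_vert_arr // ?gsrc_mul // ?sk.
Qed.

Lemma psi_mulV (p q : garr Pi) : gsrc (psi p) = gsrc (psi q) ->
  psi (gmul p (ginv q)) = gmul (psi p) (ginv (psi q)).
Proof.
move=> pq; have c : gsrc p = grng (ginv q).
  by apply: sval_inj; rewrite grng_inv; move: pq; rewrite !hom_src.
rewrite -[LHS](gmulgK (h := psi q)); last first.
  by rewrite hom_src gsrc_mul // gsrc_inv -hom_rng.
rewrite -hom_mul ?gsrc_mul ?gsrc_inv // gmulgVK //.
by rewrite c grng_inv.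
Qed.

(** An edge of F is h.sigma_e(x) for some h.  If it starts at the image of
    p G_v [v], then v = o(e) and p can be changed within its coset so that psi(p)
    equals h g_(e,y) or h, according to the orientation of e; the edge
    of the forest is then p e^-1 H_|e| [e] or p H_|e| [e]. *)
Lemma Psi_star_surj (b : vert (bsf wD)) f : org f = Psi0 b ->
  exists2 a, org a = b & Psi1 a = f.
Proof.
have [p [v ->]] := coset_vertP b; have [h [e ->]] := edge_cover f.
rewrite Psi0E org_actE; last by rewrite -/(momE A _) mom_sigE.
rewrite org_sigE; case: asboolP => pe.
  (* q is the representative of the coset of p with psi(q) = h g_(e,y). *)
  set y := phi0 GG (bar e) _.
  have c : gsrc h = grng (g_ext e y) by rewrite grng_g_ext phi0_barE.
  have gy : gsrc (gmul h (g_ext e y)) = y by rewrite gsrc_mul // gsrc_g_ext.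
  rewrite -actVM ?gsrc_g_ext ?mom_sigV // -[X in sigV _ X]gy.
  move=> /esym /translate_sigV_eq[ve rr vk]; subst v.
  have pk : gsrc (psi p) = grng (gmul (ginv (psi p)) (gmul h (g_ext e y))).
    by rewrite grng_mul ?grng_inv ?gsrc_inv.
  pose q := gmul p (vert_arr vk).
  have qE : psi q = gmul h (g_ext e y) by rewrite psi_mul_vert_arr // gmulVKg.
  have sq : gsrc q = gsrc (edge_arr e y).
    by apply: sval_inj; rewrite -!psi_obj -!hom_src qE gy psi_edge_arr gsrc_g_ext.
  pose u := gmul q (ginv (edge_arr e y)).
  have uE : psi u = h.
    by rewrite psi_mulV qE psi_edge_arr ?gmulgK // gy gsrc_g_ext.
  exists (coset_edge u e); last by rewrite Psi1E uE.
  rewrite org_coset_edge asboolT // pi1_mul_edge_arr uE -/y gmulgVK //.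
  apply/esym/coset_vert_eq/cosetP.
  by exists (gmul (ginv (psi p)) (gmul h (g_ext e y))), vk.
move=> /esym /translate_sigV_eq[ve rr vk]; subst v.
have pk : gsrc (psi p) = grng (gmul (ginv (psi p)) h).
  by rewrite grng_mul ?grng_inv ?gsrc_inv.
have qE : psi (gmul p (vert_arr vk)) = h by rewrite psi_mul_vert_arr // gmulVKg.
exists (coset_edge (gmul p (vert_arr vk)) e); last by rewrite Psi1E qE.
rewrite org_coset_edge asboolF //; apply/esym/coset_vert_eq/cosetP.
by exists (gmul (ginv (psi p)) h), vk.
Qed.

(** * Connectedness of the fibers of the Bass-Serre forest *)

(** Relation (R1). *)
Lemma edge_arr_tree e x (p : garr Pi) : Te e -> gsrc (psi p) = x ->
  gmul p (edge_arr e x) = p.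
Proof.
move=> te px; rewrite -[RHS]gmulg1; congr (gmul p _).
apply/pr_clsE; move: px; rewrite hom_src /= => ->.
rewrite -[X in Wid X](tau_id (org e) x).
exact/(@weq_rel (pi1_presentation wD T r))/rel_R1/vert_unit.
Qed.

Lemma linked_tree_edge (p : garr Pi) e : Te e ->
  linked (coset_vert p (trm e)) (coset_vert p (org e)).
Proof.
move=> te; have bte : Te (bar e) by apply: sub_bar.
have oE f : Te f -> org (coset_edge p f) = coset_vert p (org f).
  move=> tf; rewrite org_coset_edge; case: asboolP => // _.
  by rewrite pi1_mul_edge_arr edge_arr_tree // phi0_tree //; apply: sub_bar.
rewrite -oE // -[trm e]org_bar -oE // -bar_coset_edge org_bar.
exact/linked_sym/linked_edge.
Qed.

(** By (R1), a tree edge e gives an edge between p G_(o(e)) and p G_(t(e)). *)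
Lemma linked_change_tag (p : garr Pi) v w :
  linked (coset_vert p v) (coset_vert p w).
Proof.
have [q hq] := (mtree_tree T).1 (tvtx T v) (tvtx T w).
suff h (y z : vert T) : gpath y q z ->
    linked (coset_vert p (sval y)) (coset_vert p (sval z)).
  exact: (h _ _ hq).
elim: q y {hq} => [|e q IH] y /=; first by move=> ->; apply: linked_refl.
by move=> [<- /IH]; apply: linked_trans; apply/linked_tree_edge/(svalP e).
Qed.

(** It suffices to undo one generator: an element of G_v' does not change the
    coset of G_v', and the symbol of an edge e joins q e G_(o(e)) to q G_(t(e)) by
    an edge.  The passage between different tags is [linked_change_tag]. *)
Lemma linked_right_mul (t q : garr Pi) v : gsrc q = grng t ->
  linked (coset_vert (gmul q t) v) (coset_vert q v).
Proof.
have QV (t' : garr Pi) :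
    (forall q v, gsrc q = grng t' ->
      linked (coset_vert (gmul q t') v) (coset_vert q v)) ->
    forall q v, gsrc q = grng (ginv t') ->
      linked (coset_vert (gmul q (ginv t')) v) (coset_vert q v).
  move=> IH q' v' qt; have := IH (gmul q' (ginv t')) v'.
  rewrite gsrc_mul // gsrc_inv gmulgVK; last by rewrite qt grng_inv.
  by move=> /(_ erefl)/linked_sym.
move: q v; elim/pi1_ind: t.
- by move=> x q v; rewrite grng_id => <-; rewrite gmulg1; apply: linked_refl.
- move=> v' g vg q v qg.
  apply: linked_trans (linked_change_tag _ v v') _.
  apply: linked_trans (linked_change_tag _ v' v).
  suff -> : coset_vert (gmul q (vert_arr vg)) v' = coset_vert q v'.
    exact: linked_refl.
  apply/esym/coset_vert_eq/cosetP; exists g, vg; split=> //.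
  by rewrite -(psi_vert_arr vg) hom_src hom_rng qg.
- have pos e x : d_pos D e -> forall q v, gsrc q = grng (edge_arr e x) ->
      linked (coset_vert (gmul q (edge_arr e x)) v) (coset_vert q v).
    move=> pe q v qe.
    have qx : phi0 GG (bar e) (gsrc (psi q)) = x.
      by rewrite hom_src qe -hom_rng psi_edge_arr grng_g_ext phi0K.
    have qE : pi1_mul_edge q e = gmul q (edge_arr e x) by rewrite pi1_mul_edge_arr qx.
    apply: linked_trans (linked_change_tag _ v (org e)) _.
    apply: linked_trans (linked_change_tag _ (trm e) v).
    have := linked_edge (coset_edge q e).
    rewrite -[trm (coset_edge q e)]org_bar bar_coset_edge !org_coset_edge.
    by rewrite (pos_bar (d_pos_orient D)) asboolT //= org_bar qE.
  move=> e x; case: (pselect (d_pos D e)) => [pe|npe]; first exact: pos.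
  suff -> : edge_arr e x = ginv (edge_arr (bar e) (phi0 GG e x)).
    by apply/QV/pos; have [[]|[]] := (d_pos_orient D).2 e I.
  have := pi1_edgeV wD T r (vert_unit (org (bar e)) (phi0 GG e x)) (vert_unit _ _).
  rewrite -/(edge_arr _ _) => ->.
  have: phi0 GG (bar e) (phi0 GG e x) = x by apply: phi0K.
  move: (phi0 GG (bar e) _) => z ->.
  by move: (vert_unit _ _); rewrite barK => ?; apply: pi1_edge_irr.
- exact: QV.
- move=> s t st IHs IHt q v; rewrite grng_mul // => qs.
  rewrite gmulA //; apply: linked_trans (IHt _ _ _) (IHs _ _ qs).
  by rewrite gsrc_mul.
Qed.

Lemma mom_Psi0 p v : mom A (Psi0 (coset_vert p v)) = grng (psi p).
Proof. by rewrite Psi0E mom_actV // mom_sigV. Qed.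

Lemma linked_fiber (a b : vert (bsf wD)) :
  mom A (Psi0 a) = mom A (Psi0 b) -> linked a b.
Proof.
have [p [v ->]] := coset_vertP a; have [q [w ->]] := coset_vertP b.
rewrite !mom_Psi0 => /pi1_rng_eq pq.
have h (s : garr Pi) : linked (coset_vert s v) (coset_vert (gid (grng s)) v).
  by rewrite -{1}[s]gmul1g; apply: linked_right_mul; rewrite gsrc_id.
apply: linked_trans (h p) _; rewrite pq.
exact: linked_trans (linked_sym (h q)) (linked_change_tag _ _ _).
Qed.

(** * Bijectivity of both homomorphisms *)

Lemma Psi0_inj : injective Psi0.
Proof.
move=> a b ab; apply: (@immersion_tree_inj _ _ Psi Psi_star_inj) => //.
  by move=> p; apply: fiber_reduced.
by apply: linked_fiber; rewrite ab.
Qed.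

Lemma Psi1_inj : injective Psi1.
Proof.
move=> a b ab; apply: Psi_star_inj => //.
by apply: Psi0_inj; rewrite -!Psi_org ab.
Qed.

Lemma Psi0_surj w : exists a, Psi0 a = w.
Proof.
pose u := coset_vert (gid (exist _ (mom A w) (vert_unit r _) : gobj Pi)) r.
have [p hp] : linked w (Psi0 u).
  by apply: (fiber_linked treeF); rewrite mom_Psi0 hom_id grng_id.
by have [a _ <-] := @path_lifting _ _ Psi Psi_star_surj _ _ _ hp; exists a.
Qed.

Lemma Psi1_surj f : exists a, Psi1 a = f.
Proof.
by have [b /esym /Psi_star_surj[a _ <-]] := Psi0_surj (org f); exists a.
Qed.

Lemma psi_inj : injective psi.
Proof.
move=> p q pq; have : coset_vert p r = coset_vert q r.
  by apply: Psi0_inj; rewrite !Psi0E pq.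
move=> /(congr1 (fun a => (sval a).2)) /= /vcoset_eqP /cosetP[k [vk [_ pk qE]]].
have k1 : k = gid (grng k).
  apply: (@gmulgI _ (psi p)); rewrite ?grng_id //.
  by rewrite -(psi_mul_vert_arr vk) // -qE -pk gmulg1.
by rewrite qE (vert_arr_eq vk (vert_unit r (grng k)) erefl k1) vert_arr1.
Qed.

Lemma psi_surj g : exists p, psi p = g.
Proof.
have [a] := Psi0_surj (actV A g (sigV r (gsrc g))).
have [p [v ->]] := coset_vertP a; rewrite Psi0E => /translate_sigV_eq[_ pg vk].
exists (gmul p (vert_arr vk)); rewrite psi_mul_vert_arr ?gmulVKg //.
by rewrite grng_mul ?grng_inv ?gsrc_inv.
Qed.

End Desingularization.

Theorem theorem7p3 (G : groupoid) (F : graph) (A : action G F)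
  (noinv : without_inversion A) (forestF : is_forest F)
  (treeF : forall x : gobj G, is_tree (fiber A x))
  (D : desingularization A) (wD : wide (d_gog D)) :
  exists psi : groupoid_hom (pi1 wD) G,
    [/\ unique (@is_psi G F A D wD) psi,
        groupoid_iso psi &
        exists Psi : graph_hom (bsf wD) F,
          unique (is_Psi psi) Psi /\ graph_iso Psi].
Proof.
exists (psi wD); split.
- by split; [exact: is_psi_psi | exact: psi_unique].
- by apply: bij_groupoid_iso; [exact: psi_inj | exact: psi_surj].
- exists (Psi wD treeF); split.
    by split; [exact: is_Psi_Psi | exact: Psi_unique].
  apply: bij_graph_iso; [exact: Psi0_inj | exact: Psi0_surj | exact: Psi1_inj |].
  exact: Psi1_surj.
Qed.
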